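(* Let $\kappa$ be a regular uncountable cardinal. Every omega-field of the form $\mathbb K=\mathbb R((G))_\kappa$ admits an analytic logarithm. More generally, if $\mathbf k$ is an exponential field, then every omega-field of the form $\mathbb K=\mathbf k((G))_\kappa$ admits an analytic logarithm.
   Context: An exponential field is a real closed field $\mathbf k$ with an isomorphism of ordered groups $\exp:(\mathbf k,+,0,<)\cong(\mathbf k^{>0},\cdot,1,<)$; its inverse is the logarithm of $\mathbf k$. For an ordered field $\mathbf k$ and a multiplicative ordered abelian group $G$, the Hahn field $\mathbf k((G))$ consists of formal series $\sum_{g\in G}g\,r_g$ with reverse well-ordered support, componentwise addition, Cauchy product, ordered by the sign of the leading coefficient (coefficient of the largest support element); $\mathbf k((G))_\kappa$ is the subfield of series whose support has reverse order type $<\kappa$. Write $x\prec y$ if $c|x|<|y|$ for all $c\in\mathbf k^{>0}$. In $\mathbb K=\mathbf k((G))_\kappa$ the valuation ring is $\{x:|x|\le r \text{ for some } r\in\mathbf k\}$ and $G$ is the group of monomials. A real closed field $\mathbb K$ with a convex valuation ring and a group of monomials $G\subseteq\mathbb K^{>0}$ (a subgroup containing exactly one representative of each class of the relation $x\asymp y$, i.e. $|x|\le c|y|$ and $|y|\le c|x|$ for some $c$ in the valuation ring) is an omega-field if there is an isomorphism of ordered groups $\omega:(\mathbb K,+,0,<)\cong(G,\cdot,1,<)$ (an omega-map). An analytic logarithm on $\mathbb K=\mathbf k((G))_\kappa$ is a surjective order-preserving group homomorphism $\log:(\mathbb K^{>0},\cdot)\to(\mathbb K,+)$ such that (1) it extends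 the logarithm of $\mathbf k$; (2) $\log(1+\varepsilon)=\sum_{n\ge1}(-1)^{n+1}\varepsilon^n/n$ for all $\varepsilon\prec 1$ in $\mathbb K$; (3) $\log(G)=\mathbb K^{\uparrow}:=\mathbf k((G^{>1}))\cap\mathbb K$ (the purely infinite series). *)

(* Defs.v *)
From HB Require Import structures.
From mathcomp Require Import all_boot all_order all_algebra.
From mathcomp Require Import boolp classical_sets functions cardinality fsbigop.

Set Implicit Arguments.
Unset Strict Implicit.
Unset Printing Implicit Defensive.

Import Order.TTheory GRing.Theory Num.Theory.

Local Open Scope classical_set_scope.
Local Open Scope ring_scope.

HB.mixin Record isOrderedAbelianGroup (d : Order.disp_t) G
    of Group G & Order.Total d G := {
  oag_mulC : forall x y : G, (x * y)%g = (y * x)%g;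
  oag_ltM2l : forall z x y : G, (x < y)%O -> ((z * x)%g < (z * y)%g)%O
}.

#[short(type="orderedAbelianGroupType")]
HB.structure Definition OrderedAbelianGroup (d : Order.disp_t) :=
  {G of isOrderedAbelianGroup d G & Group G & Order.Total d G}.

Definition reverse_well_ordered (d : Order.disp_t) (G : orderType d)
    (A : set G) : Prop :=
  forall B : set G, B `<=` A -> B !=set0 ->
    exists2 m, B m & forall x, B x -> (x <= m)%O.

Lemma card_le_fun T U (u0 : U) (A : set T) (B : set U) : (A #<= B)%card ->
  exists2 f : T -> U, (forall x, A x -> B (f x)) &
    (forall x y, A x -> A y -> f x = f y -> x = y).
Proof.
move=> /card_leP/unsquash f.
exists (fun x => if pselect (A x) is left p
  then set_val (f (SigSub (mem_set p))) else u0) => [x Ax|x y Ax Ay].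
  by case: pselect => // p; apply: set_valP.
case: pselect => // p; case: pselect => // q /val_inj /inj.
by rewrite !inE => /(_ I I)/(congr1 val).
Qed.

Section ReverseWellOrdered.
Context (d : Order.disp_t) (G : orderedAbelianGroupType d).
Implicit Types (A B E : set G) (x y z g : G).
Local Open Scope order_scope.
Local Open Scope group_scope.
Local Notation rwo := (@reverse_well_ordered d G).

Lemma oag_leM2l z x y : (z * x <= z * y) = (x <= y).
Proof.
apply/idP/idP; last first.
  by rewrite !le_eqVlt => /orP[/eqP->|/(oag_ltM2l z)->]; rewrite ?eqxx ?orbT.
by apply: contraTT; rewrite -!ltNge; apply: oag_ltM2l.
Qed.

Lemma oag_leM x y z t : x <= y -> z <= t -> x * z <= y * t.
Proof.
move=> xy zt; apply: (@le_trans _ _ (x * t)); first by rewrite oag_leM2l.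
by rewrite ![_ * t]oag_mulC oag_leM2l.
Qed.

Lemma oag_leV x y : (x^-1 <= y^-1) = (y <= x).
Proof.
rewrite -[LHS](oag_leM2l x) mulgV -[LHS](oag_leM2l y) mulg1.
by rewrite [x / y]oag_mulC mulVKg.
Qed.

Lemma rwo_sub A B : A `<=` B -> rwo B -> rwo A.
Proof. by move=> AB rB C CA; apply: rB => x /CA/AB. Qed.

Lemma rwo_seq A (s : nat -> G) : rwo A -> (forall n, A (s n)) ->
  exists h : nat -> nat, {homo h : i j / (i < j)%N} /\
    (forall i j, (i <= j)%N -> s (h j) <= s (h i)).
Proof.
move=> rA sA.
have /choice[nx nxP] : forall n, exists m,
    (n < m)%N /\ (forall j, (n < j)%N -> s j <= s m).
  move=> n.
  have [|| _ [m nm <-] mP] := rA [set s m | m in [set m | (n < m)%N]].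
  - by move=> _ [m _ <-].
  - by exists (s n.+1); exists n.+1 => /=.
  - by exists m; split=> // j nj; apply: mP; exists j.
pose h n := iter n.+1 nx 0%N.
have hS n : h n.+1 = nx (h n) by [].
have hlt : {homo h : i j / (i < j)%N}.
  by apply: homo_ltn => [|n]; [exact: ltn_trans | rewrite hS; case: (nxP (h n))].
exists h; split=> // i j; rewrite leq_eqVlt => /orP[/eqP->//|ij].
rewrite /h iterS; have [_ ] := nxP (iter i nx 0%N); apply.
by apply: (ltn_trans (nxP _).1 (hlt _ _ ij)).
Qed.

Lemma seq_rwo A :
  (forall s : nat -> G, (forall n, A (s n)) ->
    exists i j, (i < j)%N /\ s j <= s i) -> rwo A.
Proof.
move=> sA B BA [b Bb]; apply: contrapT => nomax.
have /choice[f fP] : forall x, exists y, B x -> B y /\ x < y.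
  move=> x; have [Bx|] := pselect (B x); last by exists x.
  apply: contrapT => /forallNP ny; apply: nomax; exists x => // y By.
  by rewrite leNgt; apply/negP => xy; apply: (ny y).
pose s n := iter n f b.
have Bs n : B (s n) by elim: n => //= n /fP[].
have slt : {homo s : i j / (i < j)%N >-> i < j}.
  apply: homo_ltn => [|n]; first exact: lt_trans.
  by have [] := fP _ (Bs n).
have [i [j [ij]]] := sA s (fun n => BA _ (Bs n)).
by rewrite leNgt slt.
Qed.

Definition gprod A B : set G := [set g | exists a b, [/\ A a, B b & g = a * b]].

Lemma rwo_gprod A B : rwo A -> rwo B -> rwo (gprod A B).
Proof.
move=> rA rB; apply: seq_rwo => s.
move=> /choice[a /choice[b abP]].
have [n|h [hlt hle]] := @rwo_seq A a rA; first by case: (abP n).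
have [n|h' [h'lt h'le]] := @rwo_seq B (b \o h) rB; first by case: (abP (h n)).
exists (h (h' 0%N)), (h (h' 1%N)); split; first by apply/hlt/h'lt.
have [_ _ ->] := abP (h (h' 1%N)); have [_ _ ->] := abP (h (h' 0%N)).
by apply: oag_leM; [apply/hle/ltnW/h'lt | apply: h'le].
Qed.

Lemma rwo_setU A B : rwo A -> rwo B -> rwo (A `|` B).
Proof.
move=> rA rB C CAB [c Cc].
have [[x [Ax Cx]]|nA] := pselect ((A `&` C) !=set0); last first.
  apply: rB => [x Cx|]; last by exists c.
  by have [Ax|//] := CAB x Cx; case: nA; exists x.
have [||m [Am Cm] mP] := rA (A `&` C); [by move=> ? []|by exists x|].
have [[y [By Cy]]|nB] := pselect ((B `&` C) !=set0); last first.
  exists m => // z Cz; have [Az|Bz] := CAB z Cz; first exact: mP.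
  by case: nB; exists z.
have [||m' [Bm' Cm'] mP'] := rB (B `&` C); [by move=> ? []|by exists y|].
exists (Order.max m m'); first by rewrite /Order.max; case: ifP.
move=> z Cz; rewrite le_max.
by have [Az|Bz] := CAB z Cz; [rewrite mP|rewrite orbC mP'].
Qed.

Lemma rwo_fiber A B g : rwo A -> rwo B ->
  finite_set [set a | A a /\ B (a^-1 * g)].
Proof.
move=> rA rB; apply: contrapT => /infiniteP /(card_le_fun 1)[a aP' ainj].
have aP n : A (a n) /\ B ((a n)^-1 * g) by apply: aP'.
have [n|h [hlt hle]] := @rwo_seq A a rA; first by case: (aP n).
have [n|h' [h'lt h'le]] := @rwo_seq B (fun n => (a (h n))^-1 * g) rB.
  by case: (aP (h n)).
have := h'le 0%N 1%N isT; rewrite ![_ * g]oag_mulC oag_leM2l oag_leV => le1.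
have le2 := hle _ _ (ltnW (h'lt 0%N 1%N isT)).
have /ainj e : a (h (h' 0%N)) = a (h (h' 1%N)) by apply: le_anti; rewrite le1 le2.
by have := hlt _ _ (h'lt 0%N 1%N isT); rewrite e // ltnn.
Qed.

Fixpoint gpow E n : set G := if n is m.+1 then gprod E (gpow E m) else [set 1].
Definition gmonoid E : set G := [set g | exists n, gpow E n g].

Lemma min_bad_seq (T : Type) (len : T -> nat) (P : (nat -> T) -> Prop) s0 :
  P s0 ->
  (forall m : nat -> T, (forall j, exists2 s, P s & forall i, (i < j)%N -> s i = m i) -> P m) ->
  exists2 m, P m &
    forall n t, P t -> (forall i, (i < n)%N -> t i = m i) -> (len (m n) <= len (t n))%N.
Proof.
move=> Ps0 Plim.
have /choice[F FP] : forall ns : nat * (nat -> T), exists s', P ns.2 ->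
    [/\ P s', forall i, (i < ns.1)%N -> s' i = ns.2 i &
    forall t, P t -> (forall i, (i < ns.1)%N -> t i = ns.2 i) ->
      (len (s' ns.1) <= len (t ns.1))%N].
  move=> [n s] /=; have [Ps|] := pselect (P s); last by exists s.
  pose Q k := `[< exists t, [/\ P t, forall i, (i < n)%N -> t i = s i & len (t n) = k] >].
  have exQ : exists k, Q k by exists (len (s n)); apply/asboolP; exists s.
  case: (ex_minnP exQ) => k /asboolP[t [Pt tP tk]] kmin.
  exists t => _; split=> // t' Pt' t'P; rewrite tk; apply: kmin.
  by apply/asboolP; exists t'.
pose S := fix S n := if n is k.+1 then F (k, S k) else s0.
have PS n : P (S n) by elim: n => //= n /(FP (n, _))[].
pose m n := S n.+1 n.
have Sm j : forall i, (i < j)%N -> S j i = m i.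
  elim: j => // j IH i; rewrite ltnS leq_eqVlt => /orP[/eqP->//|ij].
  by have [_ SP _] := FP (j, S j) (PS j); rewrite /= SP //= IH.
exists m; first by apply: Plim => j; exists (S j) => //; apply: Sm.
move=> n t Pt tm; have [_ _] := FP (n, S n) (PS n); apply=> //= i ij.
by rewrite tm // Sm.
Qed.

Lemma rwo_gmonoid E : rwo E -> (forall x, E x -> x < 1) -> rwo (gmonoid E).
Proof.
move=> rE E1.
have pw1 n g : gpow E n g -> g <= 1.
  elim: n g => [g ->//|n IH _ [a [b [Ea Eb ->]]]].
  by rewrite -[leRHS]mulg1; apply: oag_leM; [apply/ltW/E1 | apply: IH].
apply: seq_rwo => s /choice[l slP]; apply: contrapT => nobad.
pose P (u : nat -> nat * G) := (forall i, gpow E (u i).1 (u i).2) /\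
   (forall i j, (i < j)%N -> (u i).2 < (u j).2).
have [|m mlim|m [mE mbad] mmin] := @min_bad_seq _ fst P (fun n => (l n, s n)).
- split=> [i|i j ij] /=; first exact: slP.
  by rewrite ltNge; apply/negP => le; apply: nobad; exists i, j.
- split=> [i|i j ij].
    by have [u [uE _] <-] := mlim i.+1.
  have [u [_ ub] uP] := mlim j.+1.
  by rewrite -!uP ?ub // ltnS ltnW.
have /choice[e /choice[v /choice[q evP]]] : forall n, exists e v q,
    [/\ E e, gpow E q v, (m n).1 = q.+1 & (m n).2 = e * v].
  move=> n; have := mE n; have := mbad n n.+1 (ltnSn n).
  case: (m n) => [[|q] g] /=.
    by move=> + g1; rewrite g1 ltNge (pw1 _ _ (mE n.+1)).
  by move=> _ [a [b [? ? ->]]]; exists a, b, q.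
have [n|h [hlt hle]] := @rwo_seq E e rE; first by case: (evP n).
have hge i : (h 0%N <= h i)%N by case: i => // i; apply/ltnW/hlt.
pose t i := if (i < h 0%N)%N then m i else (q (h (i - h 0%N)), v (h (i - h 0%N)))%N.
have tE i : gpow E (t i).1 (t i).2.
  by rewrite /t; case: ifP => // _; case: (evP (h (i - h 0%N)%N)).
have vm n : (m n).2 <= v n.
  have [Ee _ _ ->] := evP n; rewrite -[leRHS]mul1g; apply: oag_leM => //.
  exact/ltW/E1.
have tbad i j : (i < j)%N -> (t i).2 < (t j).2.
  move=> ij; rewrite /t; case: ltnP => ih; case: ltnP => jh //=.
  - exact: mbad.
  - by apply: lt_le_trans (vm _); apply: mbad; apply: leq_trans (hge _).
  - by have := leq_ltn_trans ih (ltn_trans ij jh); rewrite ltnn.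
  - rewrite ltNge; apply/negP => le.
    have lt : (h (i - h 0) < h (j - h 0))%N.
      by apply: hlt; rewrite ltn_sub2r // (leq_ltn_trans ih).
    have := mbad _ _ lt; have [_ _ _ ->] := evP (h (i - h 0))%N.
    have [_ _ _ ->] := evP (h (j - h 0))%N; rewrite ltNge oag_leM //.
    by apply: hle; rewrite leq_sub2r // ltnW.
have := mmin (h 0%N) t (conj tE tbad); rewrite /t ltnn subnn /=.
have [_ _ -> _] := evP (h 0%N); rewrite ltnn => abs.
by have : false by apply: abs => i ->.
Qed.

Lemma gpow_fin E g : rwo E -> (forall x, E x -> x < 1) ->
  exists N, forall n, (N <= n)%N -> ~ gpow E n g.
Proof.
move=> rE E1; apply: contrapT => ninf.
pose B := [set g | forall N, exists2 n, (N <= n)%N & gpow E n g].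
have Bg : B g.
  move=> N; apply: contrapT => nn; apply: ninf; exists N => n Nn Eg.
  by apply: nn; exists n.
have rM := rwo_gmonoid rE E1.
have [||m Bm mP] := rM B; [by move=> x /(_ 0%N)[n _ ?]; exists n| by exists g|].
have /choice[e /choice[v /choice[q evP]]] : forall n, exists e v q,
    [/\ E e, gpow E q v, (n <= q)%N & m = e * v].
  move=> n; have [[//|k] nk [a [b [Ea Eb mE]]]] := Bm n.+1.
  by exists a, b, k.
have [n|h [hlt hle]] := @rwo_seq E e rE; first by case: (evP n).
have [n|h' [h'lt h'le]] := @rwo_seq _ (v \o h) rM.
  by exists (q (h n)); case: (evP (h n)).
have vE n : v n = m * (e n)^-1.
  by have [_ _ _ ->] := evP n; rewrite oag_mulC mulKg.
have vcst n : v (h (h' n)) = v (h (h' 0%N)).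
  apply: le_anti; rewrite (h'le 0%N n) //= !vE oag_leM2l oag_leV.
  by apply: hle; case: n => // n; apply/ltnW/h'lt.
have gen (f : nat -> nat) : {homo f : i j / (i < j)%N} -> forall n, (n <= f n)%N.
  by move=> fh; elim=> // n /leq_ltn_trans; apply; apply: fh.
have Bv : B (v (h (h' 0%N))).
  move=> N; exists (q (h (h' N))); last by rewrite -(vcst N); case: (evP (h (h' N))).
  have [_ _ + _] := evP (h (h' N)); apply: leq_trans.
  by apply: leq_trans (gen h' h'lt N) (gen h hlt _).
have [Ee _ _ mE] := evP (h (h' 0%N)).
have := mP _ Bv; rewrite leNgt {1}mE -[X in _ < X]mul1g ![_ * v _]oag_mulC.
by rewrite oag_ltM2l // E1.
Qed.

End ReverseWellOrdered.

(* An infinite cardinal is the well-ordered type of an initial ordinal (an      *)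
(* ordinal equinumerous to none of its elements); it is regular when none of   *)
(* its cofinal subsets has a smaller cardinality.                               *)
Record regular_uncountable_cardinal (d : Order.disp_t) (kappa : orderType d) :
    Prop := RegularUncountableCardinal {
  ruc_well_ordered : forall A : set kappa, A !=set0 ->
    exists2 m, A m & forall x, A x -> (m <= x)%O;
  ruc_initial : forall a : kappa,
    ~ ([set: kappa] #<= [set x | (x < a)%O])%card;
  ruc_uncountable : ~ countable [set: kappa];
  ruc_regular : forall A : set kappa,
    (forall a, exists2 x, A x & (a <= x)%O) -> ([set: kappa] #<= A)%card
}.

(* A, with the reverse of the order of G, is isomorphic to the ordinal          *)
(* {w | w < a} for some a < kappa.                                              *)
Definition reverse_order_type_lt (d d' : Order.disp_t) (G : orderType d)
    (kappa : orderType d') (A : set G) : Prop :=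
  exists (a : kappa) (f : G -> kappa), set_bij A [set w | (w < a)%O] f /\
    (forall x y, A x -> A y -> (y < x)%O -> (f x < f y)%O).

Lemma card_le_inj_image T U (A : set T) (f : T -> U) :
  {in A &, injective f} -> (A #<= f @` A)%card.
Proof. by move=> /inj_card_eq; rewrite card_eq_le => /andP[]. Qed.

Section Small.
Context (d' : Order.disp_t) (kappa : orderType d').
Hypothesis kreg : regular_uncountable_cardinal kappa.
Local Open Scope order_scope.

Definition small T (A : set T) : Prop := ~ ([set: kappa] #<= A)%card.

Lemma small_sub T (A B : set T) : A `<=` B -> small B -> small A.
Proof. by move=> AB sB lA; apply: sB; apply: card_le_trans lA (subset_card_le AB). Qed.

Lemma small_countable T (A : set T) : countable A -> small A.
Proof. by move=> cA lA; apply: (ruc_uncountable kreg); apply: card_le_trans lA cA. Qed.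

Lemma kappa_inhabited : exists a : kappa, True.
Proof.
apply: contrapT => /forallNP na; apply: (@small_countable kappa set0) => //.
by apply: subset_card_le => x _; case: (na x).
Qed.

Lemma small_bounded T (A : set T) (f : T -> kappa) : small A ->
  exists b, forall x, A x -> f x < b.
Proof.
move=> sA; apply: contrapT => /forallNP nb.
have : ([set: kappa] #<= f @` A)%card.
  apply: (ruc_regular kreg) => a; apply: contrapT => na; apply: (nb a) => x Ax.
  by rewrite ltNge; apply/negP => ax; apply: na; exists (f x) => //; exists x.
by move=> le; apply: sA; apply: card_le_trans le (card_image_le _ _).
Qed.

Lemma small_bigcup J T (D : set J) (F : J -> set T) : small D ->
  (forall i, D i -> small (F i)) -> small (\bigcup_(i in D) F i).
Proof.
move=> sD sF leU.
have [w0 _] := kappa_inhabited.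
have [t0 _] : exists t : T, True.
  apply: contrapT => /forallNP nt.
  have /small_countable : countable (\bigcup_(i in D) F i).
    suff -> : \bigcup_(i in D) F i = set0 by [].
    by rewrite -subset0 => t; case: (nt t).
  by [].
have [g gU ginj] := card_le_fun t0 leU.
have /choice[i iP] : forall w, exists i, D i /\ F i (g w).
  by move=> w; have [i Di Fi] := gU w I; exists i.
have /choice[b bP] : forall j, exists b, D j -> forall w, i w = j -> w < b.
  move=> j; have [Dj|] := pselect (D j); last by exists w0.
  have /(small_bounded id)[b bP] : small [set w | i w = j].
    move=> le; apply: (sF j Dj); apply: card_le_trans le _.
    have /card_le_trans : ([set w | i w = j] #<= g @` [set w | i w = j])%card.
      by apply: card_le_inj_image => x y _ _; apply: ginj.
    apply; apply: subset_card_le => _ [w /= <- <-]; by case: (iP w).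
  by exists b => _ w /bP.
have [B BP] := small_bounded b sD.
have := BP _ (iP B).1; rewrite ltNge => /negP; apply.
by apply/ltW/bP => //; case: (iP B).
Qed.

Lemma small_setU T (A B : set T) : small A -> small B -> small (A `|` B).
Proof.
move=> sA sB; rewrite (_ : setU A B = \bigcup_(b in [set: bool]) if b then A else B).
  by apply: small_bigcup => [|[]] //; apply: small_countable; apply: countableP.
apply/seteqP; split=> x /=; first by case=> ?; [exists true|exists false].
by case=> -[] _; [left|right].
Qed.

Lemma small_image T U (f : T -> U) (A : set T) : small A -> small (f @` A).
Proof. by move=> sA le; apply: sA; apply: card_le_trans le (card_image_le _ _). Qed.

Lemma reverse_order_type_ltP (d : Order.disp_t) (G : orderType d) (A : set G) :
  reverse_well_ordered A -> reverse_order_type_lt kappa A <-> small A.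
Proof.
move=> rA; split=> [[a [f [[fS fI fJ] _]]] le|sA].
  apply: (ruc_initial kreg (a := a)); apply: card_le_trans le _.
  have /card_le_trans : (A #<= f @` A)%card.
    exact: card_le_inj_image.
  by apply; apply: subset_card_le => _ [x Ax <-]; apply: fS.
have [w0 _] := kappa_inhabited.
have /choice[mn mnP] : forall S : set kappa, exists m, S !=set0 ->
    S m /\ forall x, S x -> m <= x.
  move=> S; have [/(ruc_well_ordered kreg)[m Sm mP]|] := pselect (S !=set0).
    by exists m.
  by exists w0.
pose R y x := [/\ A x, A y & x < y].
have Rwf : well_founded R.
  move=> x; apply: contrapT => nx.
  have [||m [Am nm] mP] := rA [set z | A z /\ ~ Acc R z].
  - by move=> z [].
  - exists x; split=> //; apply: contrapT => nAx; apply: nx.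
    by constructor=> y [].
  - apply: nm; constructor=> y [_ Ay my]; apply: contrapT => ny.
    by have := mP y (conj Ay ny); rewrite leNgt my.
pose F x (rec : forall y, R y x -> kappa) : kappa :=
  mn [set w | forall y (Ry : R y x), rec y Ry < w].
pose f := Fix Rwf (fun=> kappa) F.
have fE x : f x = mn [set w | forall y, R y x -> f y < w].
  rewrite /f Fix_eq // => z g h gh; congr mn; apply/seteqP; split=> w /= H y Ry.
    by rewrite -gh.
  by rewrite gh.
have ub x : [set w | forall y, R y x -> f y < w] !=set0.
  have [b bP] := small_bounded f sA.
  by exists b => y [_ Ay _]; apply: bP.
have fP x : (forall y, R y x -> f y < f x) /\
    forall w, (forall y, R y x -> f y < w) -> f x <= w.
  by rewrite fE; apply: mnP; apply: ub.
have ini x : A x -> forall w, w < f x -> exists2 y, A y & f y = w.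
  elim: (Rwf x) => {}x _ IH Ax w wfx.
  have [y Rxy wy] : exists2 y, R y x & w <= f y.
    apply: contrapT => ny; have := (fP x).2 w; rewrite leNgt wfx => /(_ _)H.
    suff: false by []; apply: H => y Ryx.
    by rewrite ltNge; apply/negP => wy; apply: ny; exists y.
  have [_ Ay _] := Rxy.
  by move: wy; rewrite le_eqVlt => /orP[/eqP->|/IH]; [exists y|apply].
have fmono x y : A x -> A y -> y < x -> f x < f y.
  by move=> Ax Ay yx; apply: (fP y).1.
have [b0 b0P] := small_bounded f sA.
have [aP amin] : (forall x, A x -> f x < mn [set w | forall x, A x -> f x < w]) /\
    (forall w, (forall x, A x -> f x < w) -> mn [set w | forall x, A x -> f x < w] <= w).
  by apply: mnP; exists b0.
exists (mn [set w | forall x, A x -> f x < w]), f; split=> //; split.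
- by move=> x Ax; apply: aP.
- move=> x y /set_mem Ax /set_mem Ay fxy.
  case: (ltgtP x y) => // xy; [have := fmono _ _ Ay Ax xy|have := fmono _ _ Ax Ay xy];
    by rewrite fxy ltxx.
- move=> w /= wa.
  have [y Ay wy] : exists2 y, A y & w <= f y.
    apply: contrapT => ny; move: wa; rewrite ltNge => /negP; apply.
    by apply: amin => y Ay; rewrite ltNge; apply/negP => wy; apply: ny; exists y.
  move: wy; rewrite le_eqVlt => /orP[/eqP->|/(ini y Ay)[z Az <-]].
    by exists y.
  by exists z.
Qed.

End Small.

Definition support_set (k : realFieldType) (G : Type) (f : G -> k) : set G :=
  [set g | f g != 0].

Definition hahn_support (k : realFieldType) (d d' : Order.disp_t)
    (G : orderType d) (kappa : orderType d') (f : G -> k) : bool :=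
  `[< reverse_well_ordered (support_set f) /\
      reverse_order_type_lt kappa (support_set f) >].

(* The carrier of k((G))_kappa; x g is the coefficient of g in x. *)
Record hahn (k : realFieldType) (d : Order.disp_t)
    (G : orderedAbelianGroupType d) (d' : Order.disp_t) (kappa : orderType d')
    (kappa_reg : regular_uncountable_cardinal kappa) := Hahn {
  coef :> G -> k;
  coef_subproof : hahn_support kappa coef
}.
Arguments hahn k {d} G {d' kappa} kappa_reg.

Section HahnField.
Context (k : realFieldType) (d : Order.disp_t) (G : orderedAbelianGroupType d).
Context (d' : Order.disp_t) (kappa : orderType d').
Context (kreg : regular_uncountable_cardinal kappa).
Local Notation K := (hahn k G kreg).
Local Notation rwo := (@reverse_well_ordered d G).
Local Notation smallG := (@small d' kappa G).
Implicit Types (x y z : K) (g h : G) (r : k).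

HB.instance Definition _ := [isSub for @coef k d G d' kappa kreg].
HB.instance Definition _ := [Choice of K by <:].

Lemma hahnP x y : (forall g, x g = y g) <-> x = y.
Proof. by split=> [e|->//]; apply: val_inj; apply/funext. Qed.

Lemma supp_rwo x : rwo (support_set x).
Proof. by have /asboolP[] := coef_subproof x. Qed.

Lemma supp_small x : smallG (support_set x).
Proof.
by have /asboolP[rx /(reverse_order_type_ltP kreg rx)] := coef_subproof x.
Qed.

Arguments supp_rwo : clear implicits.
Arguments supp_small : clear implicits.

Lemma mkhahn_subproof (f : G -> k) (A : set G) : rwo A -> smallG A ->
  (forall g, f g != 0 -> A g) ->
  hahn_support kappa f.
Proof.
move=> rA sA fA; have rf : rwo (support_set f) by apply: rwo_sub rA.
by apply/asboolP; split=> //; apply/(reverse_order_type_ltP kreg) => //; apply: small_sub sA.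
Qed.

Lemma hahn_term_subproof g r :
  hahn_support kappa (fun h => if h == g then r else 0).
Proof.
apply: (@mkhahn_subproof _ [set g]) => [B Bg [x Bx]||h /=].
- by exists x => // y By; rewrite (Bg y By) (Bg x Bx).
- by apply: small_countable kreg _ _ _; apply: countable1.
- by case: (eqVneq h g) => [->|_] //; rewrite eqxx.
Qed.
(* the one-term series g r *)
Definition hahn_term g r : K := Hahn kreg (hahn_term_subproof g r).

Definition monomial g : K := hahn_term g 1.
Definition hahn_const r : K := hahn_term 1%g r.

Lemma hahn_zero_subproof :
  hahn_support kappa (fun _ : G => 0 : k).
Proof.
apply: (@mkhahn_subproof _ set0) => [B B0 [x /B0//]||h /=].
- by apply: small_countable kreg _ _ _; apply: countable0.
- by rewrite eqxx.
Qed.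
Definition hahn_zero : K := Hahn kreg hahn_zero_subproof.

Lemma hahn_opp_subproof x :
  hahn_support kappa (fun g => - x g).
Proof.
apply: (@mkhahn_subproof (fun g => - x g) _ (supp_rwo x) (supp_small x)) => g /=.
by rewrite oppr_eq0.
Qed.
Definition hahn_opp x : K := Hahn kreg (hahn_opp_subproof x).

Lemma hahn_add_subproof x y :
  hahn_support kappa (fun g => x g + y g).
Proof.
apply: (@mkhahn_subproof (fun g => x g + y g) _ (rwo_setU (supp_rwo x) (supp_rwo y))
  (small_setU kreg (supp_small x) (supp_small y))) => g /=.
apply: contraNP => /not_orP[/negP nx /negP ny].
by move: nx ny; rewrite !negbK => /eqP-> /eqP->; rewrite addr0.
Qed.
Definition hahn_add x y : K := Hahn kreg (hahn_add_subproof x y).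

Fact hahn_addA : associative hahn_add.
Proof. by move=> x y z; apply/hahnP => g /=; rewrite addrA. Qed.
Fact hahn_addC : commutative hahn_add.
Proof. by move=> x y; apply/hahnP => g /=; rewrite addrC. Qed.
Fact hahn_add0 : left_id hahn_zero hahn_add.
Proof. by move=> x; apply/hahnP => g /=; rewrite add0r. Qed.
Fact hahn_addN : left_inverse hahn_zero hahn_opp hahn_add.
Proof. by move=> x; apply/hahnP => g /=; rewrite addNr. Qed.

HB.instance Definition _ :=
  GRing.isZmodule.Build K hahn_addA hahn_addC hahn_add0 hahn_addN.

Lemma hahn_coefD x y g : (x + y) g = x g + y g. Proof. by []. Qed.
Lemma hahn_coefN x g : (- x) g = - x g. Proof. by []. Qed.
Lemma hahn_coef0 g : (0 : K) g = 0. Proof. by []. Qed.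
Lemma hahn_coefB x y g : (x - y) g = x g - y g. Proof. by []. Qed.
Lemma hahn_coef_sum (I : Type) (s : seq I) (P : pred I) (F : I -> K) g :
  (\sum_(i <- s | P i) F i) g = \sum_(i <- s | P i) F i g.
Proof. exact: (big_morph (fun x : K => x g) (fun x y => hahn_coefD x y g) (hahn_coef0 g)). Qed.

(* The sum over all a, b in G with a b = g; only finitely many of its terms are *)
(* nonzero.                                                                     *)
Definition cauchy_product (x y : G -> k) (g : G) : k :=
  \sum_(a \in [set: G]) x a * y (a^-1 * g)%g.

Lemma cauchy_productE (x y : G -> k) g (s : seq G) : uniq s ->
  (forall a, x a != 0 -> y (a^-1 * g)%g != 0 -> a \in s) ->
  cauchy_product x y g = \sum_(a <- s) x a * y (a^-1 * g)%g.
Proof.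
move=> us sP; rewrite /cauchy_product (fsbig_seq _ _ us); symmetry.
apply: fsbig_widen => // a /= [_ na]; apply/eqP/negPn/negP.
by rewrite mulf_eq0 negb_or => /andP[xa ya]; apply: na; apply: sP.
Qed.

Lemma fiber_seq (A B : set G) g : rwo A -> rwo B ->
  exists2 s : seq G, uniq s & forall a, A a -> B (a^-1 * g)%g -> a \in s.
Proof.
move=> rA rB; have /finite_seqP[s sE] := rwo_fiber g rA rB.
exists (undup s) => [|a Aa Ba]; first exact: undup_uniq.
by have : [set a | A a /\ B (a^-1 * g)%g] a by []; rewrite sE mem_undup.
Qed.

Lemma gprod_small (A B : set G) : smallG A -> smallG B -> smallG (gprod A B).
Proof.
move=> sA sB.
have : smallG (\bigcup_(a in A) ((fun b => a * b)%g @` B)).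
  by apply: small_bigcup => // a _; apply: small_image.
by apply: small_sub => _ [a [b [Aa Bb ->]]]; exists a => //; exists b.
Qed.

Lemma cauchy_product_supp (x y : G -> k) g : cauchy_product x y g != 0 ->
  exists a, x a != 0 /\ y (a^-1 * g)%g != 0.
Proof.
apply: contraNP => /forallNP na; rewrite /cauchy_product fsbig1 // => a _.
apply/eqP; rewrite mulf_eq0 -[_ || _]negbK negb_or; apply/negP => /andP[xa ya].
by apply: (na a).
Qed.

Lemma cauchy_product_gprod (x y : G -> k) g : cauchy_product x y g != 0 ->
  gprod (support_set x) (support_set y) g.
Proof.
move=> /cauchy_product_supp[a [xa ya]].
by exists a, (a^-1 * g)%g; split=> //; rewrite mulVKg.
Qed.

Lemma hahn_mul_subproof x y :
  hahn_support kappa (cauchy_product x y).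
Proof.
apply: (@mkhahn_subproof (cauchy_product x y) _ (rwo_gprod (supp_rwo x) (supp_rwo y))
  (gprod_small (supp_small x) (supp_small y))) => g.
exact: cauchy_product_gprod.
Qed.
Definition hahn_mul x y : K := Hahn kreg (hahn_mul_subproof x y).

Lemma oag_divK a g : ((a^-1 * g)^-1 * g)%g = a.
Proof. by rewrite invgM invgK oag_mulC mulVKg. Qed.

Fact hahn_mulC : commutative hahn_mul.
Proof.
move=> x y; apply/hahnP => g /=.
have [s us sP] := fiber_seq g (supp_rwo x) (supp_rwo y).
rewrite (cauchy_productE us sP) (@cauchy_productE y x g [seq (a^-1 * g)%g | a <- s]).
- by rewrite big_map; apply: eq_bigr => a _; rewrite mulrC oag_divK.
- by rewrite map_inj_uniq // => a b /mulIg /invg_inj.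
- move=> a ya xa; apply/mapP; exists (a^-1 * g)%g.
    by apply: sP => //; rewrite oag_divK.
  by rewrite oag_divK.
Qed.

Fact hahn_mulA : associative hahn_mul.
Proof.
move=> x y z; apply/hahnP => g; apply/esym => /=.
have [A uA AP] := fiber_seq g (rwo_gprod (supp_rwo x) (supp_rwo y)) (supp_rwo z).
have [B uB BP] : exists2 B : seq G, uniq B &
    forall b a, a \in A -> x b != 0 -> y (b^-1 * a)%g != 0 -> b \in B.
  have /choice[s sP] : forall a, exists s : seq G,
      forall b, x b != 0 -> y (b^-1 * a)%g != 0 -> b \in s.
    by move=> a; have [s _ sP] := fiber_seq a (supp_rwo x) (supp_rwo y); exists s.
  exists (undup (flatten [seq s a | a <- A])); first exact: undup_uniq.
  move=> b a aA xb yb; rewrite mem_undup; apply/flatten_mapP; exists a => //.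
  exact: sP.
rewrite (@cauchy_productE _ z g A) //; last first.
  by move=> a xya za; apply: AP => //; apply: cauchy_product_gprod.
under eq_big_seq => a aA.
  rewrite (@cauchy_productE x y a B) //; last by move=> b; apply: BP.
  rewrite mulr_suml; over.
rewrite exchange_big /= (@cauchy_productE x _ g B) //; last first.
  move=> b xb /cauchy_product_supp[c [yc zc]].
  have bcA : (b * c)%g \in A.
    apply: AP; first by exists b, c.
    by rewrite invgM -mulgA.
  by apply: (BP b _ bcA) => //; rewrite mulKg.
apply: eq_bigr => b _; have [->|xb] := eqVneq (x b) 0.
  by rewrite mul0r big1 // => a _; rewrite !mul0r.
rewrite (@cauchy_productE y z _ [seq (b^-1 * a)%g | a <- A]).
- rewrite big_map mulr_sumr; apply: eq_bigr => a _.
  by rewrite -mulrA; congr (_ * (_ * z _)); rewrite invgM invgK -mulgA mulVKg.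
- by rewrite map_inj_uniq // => a a' /mulgI.
- move=> c yc zc; apply/mapP; exists (b * c)%g; last by rewrite mulKg.
  apply: AP; first by exists b, c.
  by rewrite /support_set /= invgM -mulgA.
Qed.

Lemma hahn_term_mul g r x h : cauchy_product (hahn_term g r) x h = r * x (g^-1 * h)%g.
Proof.
rewrite (@cauchy_productE _ x h [:: g]) //; first by rewrite big_seq1 /= eqxx.
by move=> a /=; rewrite inE; case: (eqVneq a g) => //; rewrite eqxx.
Qed.

Definition hahn_one : K := hahn_const 1.

Fact hahn_mul1 : left_id hahn_one hahn_mul.
Proof.
by move=> x; apply/hahnP => g /=; rewrite hahn_term_mul mul1r invg1 mul1g.
Qed.

Fact hahn_mulDl : left_distributive hahn_mul +%R.
Proof.
move=> x y z; apply/hahnP => g /=; rewrite -/(x + y).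
have [s us sP] := fiber_seq g (rwo_setU (supp_rwo x) (supp_rwo y)) (supp_rwo z).
rewrite !(@cauchy_productE _ z g s) //.
- by rewrite -big_split /=; apply: eq_bigr => a _; rewrite mulrDl.
- by move=> a ya za; apply: sP => //; right.
- by move=> a ya za; apply: sP => //; left.
- move=> a xya za; apply: sP => //; apply: contraNP xya => /not_orP[/negP nx /negP ny].
  by move: nx ny; rewrite !negbK => /eqP x0 /eqP y0; rewrite /= x0 y0 addr0.
Qed.

Fact hahn_one_neq0 : hahn_one != 0.
Proof.
by apply/eqP => /hahnP/(_ 1%g)/eqP; rewrite /= eqxx oner_eq0.
Qed.

HB.instance Definition _ := GRing.Zmodule_isComNzRing.Build K
  hahn_mulA hahn_mulC hahn_mul1 hahn_mulDl hahn_one_neq0.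

Lemma hahn_coefM x y g : (x * y) g = cauchy_product x y g. Proof. by []. Qed.
Lemma hahn_coef1 g : (1 : K) g = if g == 1%g then 1 else 0. Proof. by []. Qed.

Lemma gpow_coef x n g : (x ^+ n) g != 0 -> gpow (support_set x) n g.
Proof.
elim: n g => [g|n IH g].
  by rewrite expr0 hahn_coef1; case: (eqVneq g 1%g) => // _; rewrite eqxx.
rewrite exprS hahn_coefM => /cauchy_product_gprod[a [b [xa xb ->]]].
by exists a, b; split=> //; apply: IH.
Qed.

Lemma gpow_small (E : set G) n : smallG E -> smallG (gpow E n).
Proof.
move=> sE; elim: n => [|n IH] /=; last exact: gprod_small.
by apply: small_countable kreg _ _ _; apply: countable1.
Qed.

Lemma gmonoid_small (E : set G) : smallG E -> smallG (gmonoid E).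
Proof.
move=> sE; have : smallG (\bigcup_(n in [set: nat]) gpow E n).
  apply: small_bigcup => // [|n _]; last exact: gpow_small.
  by apply: small_countable kreg _ _ _; apply: countableP.
by apply: small_sub => g [n ng]; exists n.
Qed.

Lemma inv_1_sub (e : K) : (forall g, e g != 0 -> (g < 1%g)%O) ->
  exists y, y * (1 - e) = 1.
Proof.
move=> e1.
have /choice[N NP] : forall g, exists N, forall n, (N <= n)%N -> ~ gpow (support_set e) n g.
  by move=> g; apply: gpow_fin (supp_rwo e) e1.
pose f g := \sum_(n < N g) (e ^+ n) g.
have fE g m : (N g <= m)%N -> f g = (\sum_(n < m) e ^+ n) g.
  move=> Nm; rewrite hahn_coef_sum /f -!(big_mkord predT (fun n => (e ^+ n) g)).
  rewrite [RHS](big_cat_nat (leq0n _) Nm) /=.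
  rewrite [X in _ = _ + X]big1_seq ?addr0 // => n /=.
  rewrite mem_index_iota => /andP[Nn _]; apply/eqP/negPn/negP => /gpow_coef.
  exact: NP.
have fP : hahn_support kappa f.
  apply: (@mkhahn_subproof _ _ (rwo_gmonoid (supp_rwo e) e1)
    (gmonoid_small (supp_small e))).
  move=> g fg; apply: contrapT => ng; move/negP: fg; apply; apply/eqP.
  rewrite /f big1 // => n _; apply/eqP/negPn/negP => /gpow_coef ?.
  by apply: ng; exists n.
pose y : K := Hahn kreg fP.
exists y; rewrite mulrC; apply/hahnP => g.
have [s us sP] := fiber_seq g (supp_rwo (1 - e)) (rwo_gmonoid (supp_rwo e) e1).
pose m := (N g + \max_(a <- s) N (a^-1 * g)%g)%N.
have -> : ((1 - e) * y) g = ((1 - e) * \sum_(n < m) e ^+ n) g.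
  rewrite !hahn_coefM !(@cauchy_productE (1 - e) _ g s) //.
  - apply: eq_big_seq => a sa; congr (_ * _); apply: fE.
    by apply: leq_trans (leq_addl _ _); apply: leq_bigmax_seq.
  - move=> a ea; rewrite hahn_coef_sum => nz; apply: sP => //.
    apply: contrapT => nM; move/negP: nz; apply; apply/eqP.
    by rewrite big1 // => n _; apply/eqP/negPn/negP => /gpow_coef ?; apply: nM; exists n.
  - move=> a ea nz; apply: sP => //.
    apply: contrapT => nM; move/negP: nz; apply; apply/eqP.
    by rewrite /= /f big1 // => n _; apply/eqP/negPn/negP => /gpow_coef ?; apply: nM; exists n.
rewrite -opprB mulNr -subrX1 opprB hahn_coefB.
have -> : (e ^+ m) g = 0; last by rewrite subr0.
by apply/eqP/negPn/negP => /gpow_coef; apply: NP; apply: leq_addr.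
Qed.

Lemma hahn_lead x : x != 0 ->
  exists2 g, x g != 0 & forall h, (g < h)%O -> x h = 0.
Proof.
move=> x0; have [//||g xg gP] := @supp_rwo x (support_set x).
  apply: contrapT => /forallNP nx; move/negP: x0; apply; apply/eqP/hahnP => g.
  by apply/eqP/negPn/negP/nx.
exists g => // h gh; apply/eqP/negPn/negP => xh.
by have := gP h xh; rewrite leNgt gh.
Qed.

Lemma hahn_term_mulE g r x h : (hahn_term g r * x) h = r * x (g^-1 * h)%g.
Proof. exact: hahn_term_mul. Qed.

Lemma hahn_unit x : x != 0 -> exists y, y * x = 1.
Proof.
move=> x0; have [g xg gP] := hahn_lead x0.
pose u := hahn_term g^-1%g (x g)^-1.
have [|y yP] := @inv_1_sub (1 - u * x).
  move=> h; rewrite hahn_coefB hahn_coef1 hahn_term_mulE invgK.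
  case: (ltgtP h 1%g) => //= [h1|->].
    have xgh : x (g * h)%g = 0.
      by apply: gP; rewrite -[X in (X < _)%O]mulg1 oag_ltM2l.
    by rewrite xgh mulr0 subr0 eqxx.
  by rewrite mulg1 mulVf // subrr eqxx.
by exists (y * u); rewrite -mulrA -[u * x](subKr 1).
Qed.

Definition hahn_inv x : K := xget 0 [set y | y * x = 1].

Fact hahn_mulVx x : x != 0 -> hahn_inv x * x = 1.
Proof. by move=> /hahn_unit[y yx]; apply: (@xgetPex _ 0 [set y | y * x = 1]); exists y. Qed.

Fact hahn_inv0 : hahn_inv 0 = 0.
Proof.
by apply: xgetPN => y /=; rewrite mulr0 => /esym/eqP; rewrite oner_eq0.
Qed.

HB.instance Definition _ := GRing.ComNzRing_isField.Build K hahn_mulVx hahn_inv0.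

(* the coefficient of the largest element of the support is positive *)
Definition hahn_positive x : Prop :=
  exists g, 0 < x g /\ forall h, (g < h)%O -> x h = 0.
Definition hahn_lt x y : bool := `[< hahn_positive (y - x) >].
Definition hahn_le x y : bool := (x == y) || hahn_lt x y.
Definition hahn_norm x : K := if hahn_le 0 x then x else - x.

Lemma hahn_lt0P x : reflect (hahn_positive x) (hahn_lt 0 x).
Proof. by rewrite /hahn_lt subr0; apply: asboolP. Qed.

Fact hahn_lt0_add x y : hahn_lt 0 x -> hahn_lt 0 y -> hahn_lt 0 (x + y).
Proof.
move=> /hahn_lt0P[g [xg gP]] /hahn_lt0P[h [yh hP]]; apply/hahn_lt0P.
case: (ltgtP g h) => gh.
- exists h; split=> [|j hj]; rewrite hahn_coefD; first by rewrite gP // add0r.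
  by rewrite gP ?hP ?addr0 // (lt_trans gh).
- exists g; split=> [|j hj]; rewrite hahn_coefD; first by rewrite hP // addr0.
  by rewrite gP ?hP ?addr0 // (lt_trans gh).
- rewrite -gh in yh hP; exists g; split=> [|j gj]; rewrite hahn_coefD.
    exact: addr_gt0.
  by rewrite gP ?hP ?addr0.
Qed.

Fact hahn_lt0_mul x y : hahn_lt 0 x -> hahn_lt 0 y -> hahn_lt 0 (x * y).
Proof.
move=> /hahn_lt0P[g [xg gP]] /hahn_lt0P[h [yh hP]]; apply/hahn_lt0P.
have leg a : x a != 0 -> (a <= g)%O by rewrite leNgt; apply: contra => /gP->.
have leh b : y b != 0 -> (b <= h)%O by rewrite leNgt; apply: contra => /hP->.
exists (g * h)%g; split=> [|j gj]; rewrite hahn_coefM.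
  rewrite (@cauchy_productE x y _ [:: g]) //; first by rewrite big_seq1 mulKg mulr_gt0.
  move=> a xa ya; rewrite inE; apply/eqP/le_anti; rewrite leg //=.
  have := leh _ ya; rewrite -(oag_leM2l a) mulVKg ![(_ * h)%g]oag_mulC.
  by rewrite oag_leM2l.
apply/eqP/negPn/negP => /cauchy_product_gprod[a [b [xa yb jE]]].
by move: gj; rewrite ltNge jE oag_leM ?leg ?leh.
Qed.

Fact hahn_sub_gt0 x y : hahn_lt 0 (y - x) = hahn_lt x y.
Proof. by rewrite /hahn_lt subr0. Qed.

Fact hahn_lt0_ngt0 x : hahn_lt 0 x -> ~~ hahn_lt x 0.
Proof.
move=> /hahn_lt0P[g [xg gP]]; apply/negP; rewrite -hahn_sub_gt0 sub0r.
move=> /hahn_lt0P[h []]; rewrite hahn_coefN oppr_gt0 => xh hP.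
have := hP g; case: (ltgtP g h) => gh.
- by rewrite gP ?ltxx in xh.
- by move=> /(_ isT)/eqP; rewrite hahn_coefN oppr_eq0 => /eqP x0; rewrite x0 ltxx in xg.
- by rewrite -gh in xh; have := lt_trans xg xh; rewrite ltxx.
Qed.

Fact hahn_lt0_total x : x != 0 -> hahn_lt 0 x || hahn_lt x 0.
Proof.
move=> /hahn_lead[g xg gP]; case: (ltgtP (x g) 0) xg => // xg _; apply/orP.
  right; rewrite -hahn_sub_gt0 sub0r; apply/hahn_lt0P; exists g.
  by rewrite hahn_coefN oppr_gt0; split=> // h /gP xh; rewrite hahn_coefN xh oppr0.
by left; apply/hahn_lt0P; exists g.
Qed.

Fact hahn_normN x : hahn_norm (- x) = hahn_norm x.
Proof.
rewrite /hahn_norm /hahn_le opprK ![0 == _]eq_sym oppr_eq0.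
have [->|x0] /= := eqVneq x 0; first by rewrite oppr0.
have -> : hahn_lt 0 (- x) = hahn_lt x 0 by rewrite -[RHS]hahn_sub_gt0 sub0r.
have := hahn_lt0_total x0; have := @hahn_lt0_ngt0 x.
by case: (hahn_lt 0 x) => [/(_ isT)/negPf->//|_ /= ->].
Qed.

Fact hahn_ge0_norm x : hahn_le 0 x -> hahn_norm x = x.
Proof. by rewrite /hahn_norm => ->. Qed.

Fact hahn_le_def x y : hahn_le x y = (x == y) || hahn_lt x y.
Proof. by []. Qed.

HB.instance Definition _ := Num.IntegralDomain_isLtReal.Build K
  hahn_lt0_add hahn_lt0_mul hahn_lt0_ngt0 hahn_sub_gt0 hahn_lt0_total
  hahn_normN hahn_ge0_norm hahn_le_def.

End HahnField.

Arguments hahn_term {k d G d' kappa kreg} g r.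
Arguments monomial {k d G d' kappa kreg} g.
Arguments hahn_const {k d G d' kappa kreg} r.

Section OmegaField.
Variable K : realFieldType.
Implicit Types (O M : set K) (x y : K).

Definition convex_valuation_ring O : Prop :=
  [/\ O 1,
      forall x y, O x -> O y -> O (x - y),
      forall x y, O x -> O y -> O (x * y),
      forall x, O x \/ O x^-1 &
      forall x y, 0 <= x -> x <= y -> O y -> O x].

Definition asymp O x y : Prop :=
  exists c, [/\ O c, `|x| <= c * `|y| & `|y| <= c * `|x|].

Definition group_of_monomials O M : Prop :=
  [/\ forall m, M m -> 0 < m,
      M 1,
      forall m n, M m -> M n -> M (m * n),
      forall m, M m -> M m^-1 &
      forall x, x != 0 -> exists! m, M m /\ asymp O x m].

Definition omega_map M (omega : K -> K) : Prop :=
  [/\ set_bij [set: K] M omega,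
      forall x y, omega (x + y) = omega x * omega y &
      forall x y, x < y -> omega x < omega y].

Definition omega_field O M : Prop :=
  [/\ Num.real_closed_axiom K, convex_valuation_ring O,
      group_of_monomials O M & exists omega, omega_map M omega].

End OmegaField.

(* logk is the inverse of the isomorphism expk; its values outside of the       *)
(* positive elements of k are irrelevant.                                       *)
Record exponential_field (k : rcfType) (expk logk : k -> k) : Prop :=
    ExponentialField {
  expk_add : forall a b, expk (a + b) = expk a * expk b;
  expk_lt : forall a b, a < b -> expk a < expk b;
  expk_gt0 : forall a, 0 < expk a;
  expkK : forall a, logk (expk a) = a;
  logkK : forall a, 0 < a -> expk (logk a) = a
}.

Section AnalyticLogarithm.
Context (k : realFieldType) (d : Order.disp_t) (G : orderedAbelianGroupType d).
Context (d' : Order.disp_t) (kappa : orderType d').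
Context (kreg : regular_uncountable_cardinal kappa).
Local Notation K := (hahn k G kreg).
Implicit Types x y e : K.

Definition hahn_valuation_ring : set K :=
  [set x | exists r : k, `|x| <= hahn_const r].

Definition hahn_monomials : set K := range monomial.

Definition hahn_omega_field : Prop :=
  omega_field hahn_valuation_ring hahn_monomials.

Definition hahn_prec x y : Prop :=
  forall c : k, 0 < c -> hahn_const c * `|x| < `|y|.

Definition purely_infinite : set K :=
  [set x | forall g, x g != 0 -> (1%g < g)%O].

(* The family u is summable, with sum s. *)
Definition hahn_sum (u : nat -> K) (s : K) : Prop :=
  [/\ reverse_well_ordered (\bigcup_n support_set (u n)),
      forall g, finite_set [set n | u n g != 0] &
      forall g, s g = \sum_(n \in [set: nat]) u n g].

(* log is a total function; its values outside of the positive elements of K   *)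
(* are irrelevant. The n-th term of the series of log (1 + e) below is the one  *)
(* of exponent n + 1.                                                           *)
Record analytic_logarithm (logk : k -> k) (log : K -> K) : Prop :=
    AnalyticLogarithm {
  log_mul : forall x y, 0 < x -> 0 < y -> log (x * y) = log x + log y;
  log_lt : forall x y, 0 < x -> x < y -> log x < log y;
  log_surj : forall y, exists2 x, 0 < x & log x = y;
  log_const : forall r : k, 0 < r -> log (hahn_const r) = hahn_const (logk r);
  log_analytic : forall e, hahn_prec e 1 ->
    hahn_sum (fun n => (-1) ^+ n.+2 * e ^+ n.+1 / n.+1%:R) (log (1 + e));
  log_monomials : log @` hahn_monomials = purely_infinite
}.

End AnalyticLogarithm.

Arguments hahn_omega_field k {d} G {d' kappa} kreg.

(* Main.v *)
Require Import Defs.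
From mathcomp Require Import all_boot all_order all_algebra.
From mathcomp Require Import boolp classical_sets functions cardinality fsbigop.
From mathcomp Require Import ring reals exp.

Set Implicit Arguments.
Unset Strict Implicit.
Unset Printing Implicit Defensive.

Import Order.TTheory GRing.Theory Num.Theory.

Local Open Scope classical_set_scope.
Local Open Scope ring_scope.

(** Every positive x in K = k((G))_kappa is uniquely g r (1 + e) with g in G, r > 0
    in k and e infinitesimal, and log x is the sum of log g, log r and log (1 + e).

    For log g: an omega-map identifies G with K as ordered groups, so that every
    g is omega of a series with exponents in G. The order isomorphism from K onto
    its positive half-line (1 + x for x >= 0, 1 / (1 - x) for x < 0) transports to
    an order isomorphism from G onto the part of G above 1; moving the exponents
    of that series along it gives an ordered group isomorphism from G onto the
    purely infinite series.

    For log (1 + e): multiplicativity and surjectivity of the power series are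
    checked modulo the powers of the ideal generated by the support of e, whose
    intersection is 0. There they become identities of truncated polynomials in
    an auxiliary variable t over K, which hold up to order M in t because
    (1 + u) (L u)' = u' (1 - (- u) ^ M) for the truncated logarithm L; these are
    then evaluated at t = 1. *)

(** * Truncated logarithm and exponential of polynomials, modulo powers of the variable *)

Section TruncatedLogarithm.
Variable F : numFieldType.
Implicit Types (p q u v w : {poly F}) (M : nat) (a : F).

Definition vanish M p : Prop := forall i, (i < M)%N -> p`_i = 0.

Lemma vanishD M p q : vanish M p -> vanish M q -> vanish M (p + q).
Proof. by move=> p0 q0 i iM; rewrite coefD p0 ?q0 ?addr0. Qed.

Lemma vanishN M p : vanish M p -> vanish M (- p).
Proof. by move=> p0 i iM; rewrite coefN p0 ?oppr0. Qed.

Lemma vanishM M N p q : vanish M p -> vanish N q -> vanish (M + N) (p * q).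
Proof.
move=> p0 q0 i iMN; rewrite coefM big1 // => j _.
have [jM|jM] := ltnP j M; first by rewrite p0 ?mul0r.
rewrite q0 ?mulr0 // ltn_subLR; last by rewrite -ltnS.
by apply: leq_trans iMN _; rewrite leq_add2r.
Qed.

Lemma vanishMl M p q : vanish M q -> vanish M (p * q).
Proof. by move=> q0; apply: (@vanishM 0). Qed.

Lemma vanishX M u : vanish 1 u -> vanish M (u ^+ M).
Proof.
by move=> u0; elim: M => // M IH; rewrite exprS -add1n; apply: vanishM.
Qed.

(** The constant coefficient of [1 + u] is 1, so the low coefficients of [q] solve a triangular
    system and vanish by strong induction. *)
Lemma vanish_unitM M u q : vanish 1 u -> vanish M ((1 + u) * q) -> vanish M q.
Proof.
move=> u0 H i; elim/ltn_ind: i => i IH iM.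
have := H i iM; rewrite coefM big_ord_recl /= subn0 coefD coef1 u0 // addr0 mul1r.
rewrite big1 ?addr0 // => j _; rewrite IH ?mulr0 // /bump /=.
  by rewrite add1n ltn_subrL /= (leq_ltn_trans _ (ltn_ord j)).
by apply: leq_ltn_trans iM; apply: leq_subr.
Qed.

Lemma vanish_deriv M p : p`_0 = 0 -> vanish M p^`() -> vanish M.+1 p.
Proof.
move=> p0 p'0 [|i] // iM; have /eqP := p'0 i iM.
by rewrite coef_deriv mulrn_eq0 /= => /eqP.
Qed.

Definition log_trunc M u := \sum_(n < M) ((-1) ^+ n.+2 / n.+1%:R) *: u ^+ n.+1.

Lemma log_trunc_deriv M u :
  (1 + u) * (log_trunc M u)^`() = u^`() * (1 - (- u) ^+ M).
Proof.
(* The denominators cancel on differentiation and leave a finite geometric series in [- u], which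
   the factor [1 + u] then collapses. *)
have -> : (log_trunc M u)^`() = u^`() * \sum_(n < M) (- u) ^+ n.
  rewrite raddf_sum mulr_sumr; apply: eq_bigr => n _ /=.
  rewrite derivZ deriv_exp /= -[(_ * _) *+ n.+1]scaler_nat scalerA divfK ?pnatr_eq0 //.
  rewrite 2!exprS mulrA mulrNN !mul1r [in RHS]exprNn -mul_polyC rmorphXn /= polyCN.
  ring.
have := subrX1 (- u) M; set S := \sum_(n < M) _ => e.
by rewrite -[1 - _]opprB e; ring.
Qed.

Lemma log_trunc_coef0 M u : vanish 1 u -> (log_trunc M u)`_0 = 0.
Proof.
move=> u0; rewrite coef_sum big1 // => n _.
by rewrite coefZ [u ^+ _]exprS (vanishM u0 (_ : vanish 0 (u ^+ n))) ?mulr0.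
Qed.

Lemma log_trunc_deriv_vanish M u : vanish 1 u ->
  vanish M ((1 + u) * (log_trunc M u)^`() - u^`()).
Proof.
move=> u0; rewrite log_trunc_deriv mulrBr mulr1 addrAC subrr add0r.
by apply/vanishN/vanishMl/vanishX/vanishN.
Qed.

(** All constant coefficients are 0, so it suffices to compare derivatives: modulo the power [M] of
    the variable this is the identity w' / (1 + w) = u' / (1 + u) + v' / (1 + v) for 1 + w = (1 + u)
    (1 + v). *)
Lemma log_truncM M u v : vanish 1 u -> vanish 1 v ->
  vanish M.+1 (log_trunc M (u + v + u * v) - log_trunc M u - log_trunc M v).
Proof.
move=> u0 v0; set w := u + v + u * v.
have w0 : vanish 1 w by apply: vanishD; [apply: vanishD|apply: vanishMl].
apply: vanish_deriv; first by rewrite !coefB !log_trunc_coef0 // !subr0.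
apply: (vanish_unitM w0).
have wE : 1 + w = (1 + u) * (1 + v) by rewrite /w; ring.
have w'E : w^`() = (1 + v) * u^`() + (1 + u) * v^`().
  by rewrite /w !derivD derivM; ring.
have := @log_trunc_deriv_vanish M _ w0; have := @log_trunc_deriv_vanish M _ u0.
have := @log_trunc_deriv_vanish M _ v0.
rewrite !derivB; move: (deriv (log_trunc M w)) => lw.
move: (deriv (log_trunc M u)) (deriv (log_trunc M v)) => lu lv Hv Hu Hw.
(* The terms in w', u' and v' cancel by the product rule, so only the three truncation errors
   remain. *)
have -> : (1 + w) * (lw - lu - lv) = ((1 + w) * lw - w^`())
  + - ((1 + v) * ((1 + u) * lu - u^`()))
  + - ((1 + u) * ((1 + v) * lv - v^`())) by rewrite w'E wE; ring.
apply: vanishD; last exact/vanishN/vanishMl.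
by apply: vanishD => //; exact/vanishN/vanishMl.
Qed.

(** The Taylor polynomial of exp (a t) - 1, the preimage of a t under the logarithm. *)
Definition expm1_trunc M a : {poly F} :=
  \sum_(n < M) (a ^+ n.+1 / (n.+1)`!%:R) *: 'X^(n.+1).

Lemma expm1_trunc_vanish M a : vanish 1 (expm1_trunc M a).
Proof.
move=> [|//] _; rewrite coef_sum big1 // => n _.
by rewrite coefZ coefXn mulr0.
Qed.

(** This is the differential equation of exp (a t); the truncation spoils it only in degree [M]. *)
Lemma expm1_trunc_deriv M a :
  vanish M ((expm1_trunc M a)^`() - a *: (1 + expm1_trunc M a)).
Proof.
move=> i iM; rewrite coefB coefZ coef_deriv coefD coef1 !coef_sum.
have E j m : \sum_(n < m) ((a ^+ n.+1 / (n.+1)`!%:R) *: 'X^(n.+1) : {poly F})`_j.+1 =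
    if (j < m)%N then a ^+ j.+1 / (j.+1)`!%:R else 0.
  case: ltnP => jm.
    rewrite (bigD1 (Ordinal jm)) //= coefZ coefXn eqxx mulr1 big1 ?addr0 // => n.
    by rewrite coefZ coefXn -val_eqE eqSS eq_sym /= => /negPf->; rewrite mulr0.
  apply: big1 => n _; rewrite coefZ coefXn eqSS gtn_eqF ?mulr0 //.
  exact: leq_trans (ltn_ord n) jm.
rewrite E iM; case: i iM => [|i] iM.
  rewrite eqxx big1 => [|n _]; last by rewrite coefZ coefXn mulr0.
  by rewrite factS fact0 muln1 divr1 mulr1n addr0 mulr1 expr1 subrr.
rewrite E (ltnW iM) /= add0r [in X in _ - X]mulrA -exprS -[X in X - _]mulr_natr.
have nz n : n.+1%:R != 0 :> F by rewrite pnatr_eq0.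
rewrite -[_ / _ * _]mulrA (_ : _^-1 * i.+2%:R = (i.+1)`!%:R^-1) ?subrr //.
by rewrite [(i.+2)`!]factS natrM invfM mulrAC mulVf ?mul1r.
Qed.

(** With u the truncated exponential minus 1, both (1 + u) (L u)' and a (1 + u) agree with u' up to
    order [M]; dividing by the unit 1 + u and integrating gives the claim. *)
Lemma log_trunc_expm1 M a : vanish M.+1 (log_trunc M (expm1_trunc M a) - a *: 'X).
Proof.
have u0 := @expm1_trunc_vanish M a; set u := expm1_trunc M a in u0 *.
apply: vanish_deriv.
  by rewrite coefB log_trunc_coef0 // coefZ coefX mulr0 subr0.
apply: (vanish_unitM u0); have := @log_trunc_deriv_vanish M _ u0.
have := @expm1_trunc_deriv M a; rewrite -/u derivB derivZ derivX.
move: (deriv (log_trunc M u)) => lu Hu Hl.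
have -> : (1 + u) * (lu - a *: 1) = ((1 + u) * lu - u^`()) + (u^`() - a *: (1 + u)).
  by rewrite -!mul_polyC; ring.
exact: vanishD.
Qed.

End TruncatedLogarithm.

(** * The filtration of K by the length of products of elements of a set of monomials *)

Section Filtration.
Context (k : realFieldType) (d : Order.disp_t) (G : orderedAbelianGroupType d).
Context (d' : Order.disp_t) (kappa : orderType d').
Context (kreg : regular_uncountable_cardinal kappa).
Local Notation K := (hahn k G kreg).
Implicit Types (x y : K) (g h : G) (r : k) (n m : nat).

Lemma hahn_constE r g : (hahn_const r : K) g = if g == 1%g then r else 0.
Proof. by []. Qed.

Lemma hahn_constMcoef r x g : (hahn_const r * x) g = r * x g.
Proof. by rewrite hahn_term_mulE invg1 mul1g. Qed.

Lemma hahn_constD r r' : hahn_const (r + r') = hahn_const r + hahn_const r' :> K.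
Proof.
by apply/hahnP => g; rewrite hahn_coefD !hahn_constE; case: ifP; rewrite ?addr0.
Qed.

Lemma hahn_constM r r' : hahn_const (r * r') = hahn_const r * hahn_const r' :> K.
Proof.
by apply/hahnP => g; rewrite hahn_constMcoef !hahn_constE; case: ifP; rewrite ?mulr0.
Qed.

Lemma hahn_const0 : hahn_const 0 = 0 :> K.
Proof. by apply/hahnP => g; rewrite hahn_constE; case: ifP. Qed.

Lemma hahn_const1 : hahn_const 1 = 1 :> K.
Proof. by []. Qed.

Lemma hahn_const_nat n : n%:R = hahn_const n%:R :> K.
Proof.
elim: n => [|n IH]; first by rewrite hahn_const0.
by rewrite -addn1 !natrD IH hahn_constD.
Qed.

Lemma gpow_mul (E : set G) m n g h :
  gpow E m g -> gpow E n h -> gpow E (m + n) (g * h)%g.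
Proof.
elim: m g => [|m IH] g /=; first by move=> ->; rewrite mul1g.
move=> [a [b [Ea Eb ->]]] Eh; exists a, (b * h)%g.
by rewrite mulgA; split=> //; apply: IH.
Qed.

Variable E : set G.

(** A monomial can be a product of elements of [E] in several lengths; asking for some length at
    least [n] makes the filtration decreasing. *)
Definition hfilt n : set K :=
  [set x | forall g, x g != 0 -> exists2 m, (n <= m)%N & gpow E m g].

Lemma hfilt_le n m x : (n <= m)%N -> hfilt m x -> hfilt n x.
Proof.
by move=> nm xm g /xm[j mj Ej]; exists j => //; apply: leq_trans mj.
Qed.

Lemma hfilt0 n : hfilt n 0.
Proof. by move=> g; rewrite hahn_coef0 eqxx. Qed.

Lemma hfiltD n x y : hfilt n x -> hfilt n y -> hfilt n (x + y).
Proof.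
move=> nx ny g; rewrite hahn_coefD.
by have [->|/nx//] := eqVneq (x g) 0; rewrite add0r => /ny.
Qed.

Lemma hfiltN n x : hfilt n x -> hfilt n (- x).
Proof. by move=> nx g; rewrite hahn_coefN oppr_eq0 => /nx. Qed.

Lemma hfiltM n m x y : hfilt n x -> hfilt m y -> hfilt (n + m) (x * y).
Proof.
move=> nx my g; rewrite hahn_coefM => /cauchy_product_gprod[a [b]].
move=> [/nx[i ni Ea] /my[j mj Eb] ->]; exists (i + j)%N; first exact: leq_add.
exact: gpow_mul.
Qed.

Lemma hfilt_sum (I : Type) (s : seq I) (P : pred I) (F : I -> K) n :
  (forall i, P i -> hfilt n (F i)) -> hfilt n (\sum_(i <- s | P i) F i).
Proof.
by move=> FP; apply: big_ind => //; [apply: hfilt0|apply: hfiltD].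
Qed.

Lemma hfilt_const r : hfilt 0 (hahn_const r).
Proof.
move=> g; rewrite hahn_constE; case: (eqVneq g 1%g) => [->|_]; last by rewrite eqxx.
by exists 0%N.
Qed.

Lemma hfilt_natV n : hfilt 0 n%:R^-1.
Proof.
suff -> : n%:R^-1 = hahn_const n%:R^-1 :> K by apply: hfilt_const.
case: n => [|n]; first by rewrite !invr0 hahn_const0.
apply: (@mulIf _ n.+1%:R); rewrite ?pnatr_eq0 //.
by rewrite mulVf ?pnatr_eq0 // hahn_const_nat -hahn_constM mulVf ?pnatr_eq0.
Qed.

Lemma hfilt_signM n m x : hfilt m x -> hfilt m ((-1) ^+ n * x).
Proof.
move=> mx; rewrite -signr_odd; case: odd; rewrite ?expr0 ?expr1 ?mul1r ?mulN1r //.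
exact: hfiltN.
Qed.

Lemma hfiltX n x : hfilt 1 x -> hfilt n (x ^+ n).
Proof.
move=> x1; elim: n => [|n IH]; first by rewrite expr0 -hahn_const1; exact: hfilt_const.
by rewrite exprS -add1n; apply: hfiltM.
Qed.

Hypotheses (rE : reverse_well_ordered E) (sE : small kappa E).
Hypothesis (E1 : forall g, E g -> (g < 1%g)%O).

(** By [gpow_fin] (Neumann's lemma) no monomial is a product of arbitrarily many elements of [E], so
    the filtration is separated. *)
Lemma hfilt_eq0 x : (forall n, hfilt n x) -> x = 0.
Proof.
move=> xn; apply/hahnP => g; apply/eqP/negPn/negP => xg.
have [N NP] := gpow_fin g rE E1; have [m Nm] := xn N g xg; exact: NP.
Qed.

(** Completeness of the filtration: by [gpow_fin] each monomial occurs in only finitely many [u n],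
    so coefficients are finite sums, and the support stays in the monoid generated by [E], which is
    reverse well-ordered and small. *)
Lemma hfilt_sum_exists (u : nat -> K) : (forall n, hfilt n (u n)) ->
  exists2 s : K, hahn_sum u s & forall m, hfilt m (s - \sum_(n < m) u n).
Proof.
move=> un.
have /choice[N NP] : forall g, exists N, forall n, (N <= n)%N -> u n g = 0.
  move=> g; have [N NP] := gpow_fin g rE E1; exists N => n Nn.
  apply/eqP/negPn/negP => /un[m nm]; apply: NP; exact: leq_trans nm.
pose f g := \sum_(n < N g) u n g.
have uM n g : u n g != 0 -> gmonoid E g by move=> /un[m _ ?]; exists m.
have fP : hahn_support kappa f.
  apply: (@mkhahn_subproof _ _ _ _ _ kreg _ _
    (rwo_gmonoid rE E1) (gmonoid_small kreg sE)).
  move=> g fg; apply: contrapT => ng; move/negP: fg; apply; apply/eqP.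
  by rewrite /f big1 // => n _; apply/eqP/negPn/negP => /uM.
exists (Hahn kreg fP); first split.
- by apply: rwo_sub (rwo_gmonoid rE E1) => g [n _ /uM].
- move=> g; apply: sub_finite_set (finite_II (N g)) => n /= ung.
  by rewrite ltnNge; apply: contra ung => /NP->.
- move=> g /=; rewrite /f -(big_mkord predT (fun n => u n g)).
  rewrite (fsbig_seq _ _ (iota_uniq _ _)); apply: fsbig_widen => // n /= [_].
  by rewrite mem_iota add0n subn0 /= => /negP; rewrite -leqNgt => /NP.
move=> m g; rewrite hahn_coefB hahn_coef_sum /= /f => nz.
(* A monomial of the remainder must come from a term of index at least [m], hence has a
   factorization of length at least [m]. *)
have [n mn ung] : exists2 n, (m <= n)%N & u n g != 0.
  apply: contrapT => /forall2NP nn; move/negP: nz; apply; rewrite subr_eq0.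
  have un0 n : (m <= n)%N -> u n g = 0.
    by move=> mn; have [//|/negP/negPn/eqP] := nn n.
  rewrite -!(big_mkord predT (fun n => u n g)).
  have [Nm|/ltnW mN] := leqP (N g) m.
    rewrite [eqbRHS](big_cat_nat (leq0n _) Nm) /= [X in _ == _ + X]big1_seq ?addr0 //.
    by move=> n /=; rewrite mem_index_iota => /andP[/NP].
  rewrite (big_cat_nat (leq0n _) mN) /= [X in _ + X]big1_seq ?addr0 //.
  by move=> n /=; rewrite mem_index_iota => /andP[/un0].
by have [j nj Ej] := un n g ung; exists j => //; apply: leq_trans nj.
Qed.

(* The coefficient of t ^ n has filtration degree n, so evaluating at t = 1 *)
(* turns the t-adic order of vanishing into filtration degree.              *)
Definition graded (p : {poly K}) : Prop := forall n, hfilt n p`_n.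

Lemma gradedD p q : graded p -> graded q -> graded (p + q).
Proof. by move=> pG qG n; rewrite coefD; apply: hfiltD. Qed.

Lemma gradedN p : graded p -> graded (- p).
Proof. by move=> pG n; rewrite coefN; apply: hfiltN. Qed.

Lemma gradedM p q : graded p -> graded q -> graded (p * q).
Proof.
move=> pG qG n; rewrite coefM; apply: hfilt_sum => i _.
have {1}-> : n = (i + (n - i))%N by rewrite subnKC // -ltnS.
exact: hfiltM.
Qed.

Lemma gradedZ a p : hfilt 0 a -> graded p -> graded (a *: p).
Proof. by move=> a0 pG n; rewrite coefZ; apply: (hfiltM a0). Qed.

Lemma graded1 : graded 1.
Proof.
move=> n; rewrite coef1; case: (n =P 0%N) => [->|_]; last exact: hfilt0.
by rewrite /= -hahn_const1; apply: hfilt_const.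
Qed.

Lemma gradedX n p : graded p -> graded (p ^+ n).
Proof.
by move=> pG; elim: n => [|n IH]; [exact: graded1|rewrite exprS; exact: gradedM].
Qed.

Lemma graded_sum (I : Type) (s : seq I) (P : pred I) (F : I -> {poly K}) :
  (forall i, P i -> graded (F i)) -> graded (\sum_(i <- s | P i) F i).
Proof.
move=> FP; apply: big_ind => //; last exact: gradedD.
by move=> n; rewrite coef0; apply: hfilt0.
Qed.

Lemma graded_scaleX a : hfilt 1 a -> graded (a *: 'X).
Proof.
move=> a1 n; rewrite coefZ coefX; case: (n =P 1%N) => [->|_].
  by rewrite mulr1.
by rewrite mulr0; apply: hfilt0.
Qed.

Lemma graded_log_trunc m p : graded p -> graded (log_trunc m p).
Proof.
move=> pG; apply: graded_sum => n _; apply: gradedZ; last exact: gradedX.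
exact/hfilt_signM/hfilt_natV.
Qed.

Lemma graded_horner1 p m : graded p -> vanish m p -> hfilt m p.[1].
Proof.
move=> pG p0; rewrite horner_coef; apply: hfilt_sum => i _.
rewrite expr1n mulr1; have [/p0->|mi] := ltnP i m; first exact: hfilt0.
exact: hfilt_le mi (pG i).
Qed.

End Filtration.

(** * The power series of log (1 + e) on infinitesimals *)

Section LogarithmSeries.
Context (k : realFieldType) (d : Order.disp_t) (G : orderedAbelianGroupType d).
Context (d' : Order.disp_t) (kappa : orderType d').
Context (kreg : regular_uncountable_cardinal kappa).
Local Notation K := (hahn k G kreg).
Implicit Types (x y a b e u : K) (g h : G) (r : k) (n m : nat) (E : set G).

Lemma hahn_gt0P x : reflect (hahn_positive x) (0 < x).
Proof. exact: hahn_lt0P. Qed.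

Definition infinitesimal x : Prop := forall g, x g != 0 -> (g < 1%g)%O.

Lemma infinitesimal_coef_ge1 x g : infinitesimal x -> (1%g <= g)%O -> x g = 0.
Proof. by move=> x1 g1; apply/eqP/negPn/negP => /x1; rewrite ltNge g1. Qed.

Lemma hahn_sum_uniq (u : nat -> K) x y : hahn_sum u x -> hahn_sum u y -> x = y.
Proof. by move=> [_ _ xE] [_ _ yE]; apply/hahnP => g; rewrite xE yE. Qed.

Definition log1p_term e n : K := (-1) ^+ n.+2 * e ^+ n.+1 / n.+1%:R.
Definition log1p e : K := xget 0 [set s | hahn_sum (log1p_term e) s].

Lemma horner_log_trunc m (p : {poly K}) :
  (log_trunc m p).[1] = \sum_(n < m) log1p_term p.[1] n.
Proof.
rewrite horner_sum; apply: eq_bigr => n _.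
by rewrite hornerZ horner_exp /log1p_term mulrAC.
Qed.

Lemma hfilt_supp E x : support_set x `<=` E -> hfilt E 1 x.
Proof.
move=> xE g xg; exists 1%N => //; exists g, 1%g.
by rewrite mulg1; split=> //; apply: xE.
Qed.

Lemma hfilt_log1p_term E e n : hfilt E 1 e -> hfilt E n.+1 (log1p_term e n).
Proof.
move=> e1; rewrite /log1p_term -mulrA -[X in hfilt _ X]addn0.
by apply/hfilt_signM/hfiltM; [exact: hfiltX|exact: hfilt_natV].
Qed.

(** The difference of the two powers is divisible by [a - b], with a cofactor of filtration degree
    0. *)
Lemma hfilt_log1p_term_cong E m a b n : hfilt E 0 a -> hfilt E 0 b ->
  hfilt E m (a - b) -> hfilt E m (log1p_term a n - log1p_term b n).
Proof.
move=> a0 b0 ab; rewrite /log1p_term -mulrBl -mulrBr -mulrA; apply: hfilt_signM.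
rewrite -[m]addn0; apply: hfiltM; last exact: hfilt_natV.
have X0 x i : hfilt E 0 x -> hfilt E 0 (x ^+ i).
  move=> x0; elim: i => [|i IH]; last by rewrite exprS; apply: (hfiltM x0 IH).
  by rewrite expr0 -hahn_const1; apply: hfilt_const.
rewrite subrXX -[m]addn0; apply: hfiltM => //; apply: hfilt_sum => i _.
by apply: (@hfiltM _ _ _ _ _ _ _ 0 0); apply: X0.
Qed.

Section Support.
Variable E : set G.
Hypotheses (rE : reverse_well_ordered E) (sE : small kappa E).
Hypothesis (E1 : forall g, E g -> (g < 1%g)%O).

Lemma gpow_lt1 n g : gpow E n.+1 g -> (g < 1%g)%O.
Proof.
elim: n g => [|n IH] g [a [b [Ea Eb ->]]].
  by rewrite Eb mulg1; apply: E1.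
apply: lt_trans (IH _ Eb); rewrite -[X in (_ < X)%O]mul1g ![(_ * b)%g]oag_mulC.
exact/oag_ltM2l/E1.
Qed.

Lemma infinitesimal_hfilt e : hfilt E 1 e -> infinitesimal e.
Proof. by move=> e1 g /e1[[//|n] _ /gpow_lt1]. Qed.

Lemma log1p_sum_cong e : hfilt E 1 e -> hahn_sum (log1p_term e) (log1p e) /\
  forall m, hfilt E m (log1p e - \sum_(n < m) log1p_term e n).
Proof.
move=> e1.
have [n|s sS sE'] := @hfilt_sum_exists k _ _ _ _ kreg _ rE sE E1 (log1p_term e).
  exact: (hfilt_le (leqnSn n) (hfilt_log1p_term e1)).
have lS : hahn_sum (log1p_term e) (log1p e).
  by apply: (@xgetPex _ 0 [set s | hahn_sum (log1p_term e) s]); exists s.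
by split=> //; rewrite (hahn_sum_uniq lS sS).
Qed.

Lemma log1p_mul_hfilt a b : hfilt E 1 a -> hfilt E 1 b ->
  log1p (a + b + a * b) = log1p a + log1p b.
Proof.
move=> a1 b1; have c1 : hfilt E 1 (a + b + a * b).
  by apply: hfiltD; [exact: hfiltD|exact: (hfilt_le _ (hfiltM a1 b1))].
apply/eqP; rewrite -subr_eq0; apply/eqP; apply: (hfilt_eq0 rE E1) => m.
have [_ /(_ m)Ha] := log1p_sum_cong a1; have [_ /(_ m)Hb] := log1p_sum_cong b1.
have [_ /(_ m)Hc] := log1p_sum_cong c1.
(* These polynomials are graded, have no constant term, and take the values [a] and [b] at t = 1. *)
pose u : {poly K} := a *: 'X; pose v : {poly K} := b *: 'X.
have uv1 : [/\ u.[1] = a, v.[1] = b & (u + v + u * v).[1] = a + b + a * b].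
  by rewrite /u /v; split; rewrite ?hornerD ?hornerM !hornerZ !hornerX !mulr1.
have uG : graded E u by apply: graded_scaleX.
have vG : graded E v by apply: graded_scaleX.
have X1 (c : K) : vanish 1 (c *: 'X) by case=> // _; rewrite coefZ coefX mulr0.
have : hfilt E m.+1 (log_trunc m (u + v + u * v) - log_trunc m u - log_trunc m v).[1].
  apply: graded_horner1; last exact: (log_truncM (X1 a) (X1 b)).
  do 2 ![apply: gradedD; last exact/gradedN/graded_log_trunc].
  apply: graded_log_trunc; apply: gradedD; [exact: gradedD|exact: gradedM].
case: uv1 => ua vb uvE; rewrite 2!hornerD !hornerN !horner_log_trunc uvE ua vb.
set Sa := \sum_(n < m) log1p_term a n in Ha *.
set Sb := \sum_(n < m) log1p_term b n in Hb *.
set Sc := \sum_(n < m) log1p_term _ n in Hc * => HS.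
move: (log1p _) (log1p a) (log1p b) Sa Sb Sc Ha Hb Hc HS => lc la lb Sa Sb Sc Ha Hb Hc HS.
(* Three remainders of the series, plus the defect of additivity of the partial sums. *)
have -> : lc - (la + lb) = (lc - Sc) - (la - Sa) - (lb - Sb) + (Sc - Sa - Sb) by ring.
apply: hfiltD; last exact: (hfilt_le (leqnSn m)).
by do 2 ![apply: hfiltD; last exact: hfiltN].
Qed.

(** The preimage is the sum of the series exp (e) - 1. *)
Lemma log1p_surj_hfilt e : hfilt E 1 e -> exists2 u, hfilt E 1 u & log1p u = e.
Proof.
move=> e1; pose t n := e ^+ n.+1 / (n.+1)`!%:R.
have tn n : hfilt E n.+1 (t n).
  rewrite -[X in hfilt _ X]addn0; apply: hfiltM; last exact: hfilt_natV.
  exact: hfiltX.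
have [n|u _ uE] := @hfilt_sum_exists k _ _ _ _ kreg _ rE sE E1 t.
  exact: (hfilt_le (leqnSn n) (tn n)).
have u1 : hfilt E 1 u.
  rewrite -[u](subrK (\sum_(n < 1) t n)) big_ord1; apply: hfiltD (tn _).
  by have := uE 1%N; rewrite big_ord1.
exists u => //; apply/eqP; rewrite -subr_eq0; apply/eqP.
apply: (hfilt_eq0 rE E1) => m; have [_ /(_ m)Hu] := log1p_sum_cong u1.
pose p := expm1_trunc m e.
have pE : p.[1] = \sum_(n < m) t n.
  rewrite horner_sum; apply: eq_bigr => n _.
  by rewrite hornerZ hornerXn expr1n mulr1.
have pG : graded E p.
  apply: graded_sum => n _; rewrite mulrC -scalerA -exprZn.
  apply: gradedZ; first exact: hfilt_natV.
  exact/gradedX/graded_scaleX.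
have : hfilt E m.+1 (log_trunc m p - e *: 'X).[1].
  apply: graded_horner1; last exact: log_trunc_expm1.
  by apply: gradedD; [exact: graded_log_trunc|exact/gradedN/graded_scaleX].
rewrite hornerD hornerN horner_log_trunc pE hornerZ hornerX mulr1 => HS.
set v := \sum_(j < m) t j in uE HS *.
(* Two replacements modulo degree [m]: first the series by its partial sum at [u], then [u] by the
   partial sum [v] of the exponential series, where the polynomial identity applies. *)
rewrite -[log1p u - e](subrKA (\sum_(n < m) log1p_term u n)).
apply: (hfiltD Hu).
rewrite -[_ - e](subrKA (\sum_(n < m) log1p_term v n)).
apply: hfiltD; last exact: (hfilt_le (leqnSn m)).
rewrite -sumrB; apply: hfilt_sum => n _.
apply: hfilt_log1p_term_cong (uE m); first exact: (hfilt_le _ u1).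
by apply: hfilt_sum => j _; apply: (hfilt_le _ (tn j)).
Qed.

End Support.

Lemma log1p_sum e : infinitesimal e -> hahn_sum (log1p_term e) (log1p e).
Proof.
move=> e1; have eE : hfilt (support_set e) 1 e by apply: hfilt_supp.
by have [] := log1p_sum_cong (supp_rwo (x := e)) (supp_small (x := e)) e1 eE.
Qed.

Lemma log1p_mul a b : infinitesimal a -> infinitesimal b ->
  log1p (a + b + a * b) = log1p a + log1p b.
Proof.
move=> a1 b1; apply: (@log1p_mul_hfilt (support_set a `|` support_set b)).
- by apply: rwo_setU; apply: supp_rwo.
- by apply: small_setU => //; apply: supp_small.
- by move=> g [/a1|/b1].
- by apply: hfilt_supp => g ?; left.
- by apply: hfilt_supp => g ?; right.
Qed.

Lemma infinitesimal0 : infinitesimal 0.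
Proof. by move=> g; rewrite hahn_coef0 eqxx. Qed.

Lemma log1p0 : log1p 0 = 0.
Proof.
have := log1p_mul infinitesimal0 infinitesimal0; rewrite mulr0 !addr0 => /eqP.
by rewrite -subr_eq0 opprD addNKr oppr_eq0 => /eqP.
Qed.

Lemma log1p_surj e : infinitesimal e -> exists2 u, infinitesimal u & log1p u = e.
Proof.
move=> e1.
have [|u u1 <-] := log1p_surj_hfilt (supp_rwo (x := e)) (supp_small (x := e)) e1 (e := e).
  exact: hfilt_supp.
by exists u => //; apply: infinitesimal_hfilt u1.
Qed.

Lemma infinitesimal_log1p e : infinitesimal e -> infinitesimal (log1p e).
Proof.
move=> e1; have eE : hfilt (support_set e) 1 e by apply: hfilt_supp.
have [_ /(_ 1%N)] := log1p_sum_cong (supp_rwo (x := e)) (supp_small (x := e)) e1 eE.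
rewrite big_ord1 => H; apply: (infinitesimal_hfilt e1).
rewrite -[log1p e](subrK (log1p_term e 0)); apply: hfiltD => //.
exact: hfilt_log1p_term.
Qed.

(** Modulo filtration degree 2 the series is [e], and products of two or more monomials of [e] lie
    below its leading monomial; hence the leading terms agree. *)
Lemma log1p_gt0 e : infinitesimal e -> 0 < e -> 0 < log1p e.
Proof.
move=> e1 /hahn_gt0P[g0 [eg0 g0P]].
have eE : hfilt (support_set e) 1 e by apply: hfilt_supp.
have [_ /(_ 2%N)] := log1p_sum_cong (supp_rwo (x := e)) (supp_small (x := e)) e1 eE.
rewrite big_ord_recr big_ord1 /= {1}/log1p_term -signr_odd /= expr0 expr1 mul1r divr1.
move=> /hfiltD /(_ (hfilt_log1p_term (n := 1) eE)); rewrite opprD addrA subrK => H.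
have z h : (g0 <= h)%O -> (log1p e) h = e h.
  move=> g0h; apply/eqP; rewrite -subr_eq0 -hahn_coefB; apply/negPn/negP => /H.
  move=> [[|[|n]] // _ [a [b [ea /(gpow_lt1 e1) b1 hE]]]].
  suff: (h < g0)%O by rewrite ltNge g0h.
  rewrite hE; apply: (@lt_le_trans _ _ (a * 1)%g); first exact: oag_ltM2l.
  by rewrite mulg1 leNgt; apply/negP => /g0P ea0; move: ea; rewrite /support_set /= ea0 eqxx.
apply/hahn_gt0P; exists g0; rewrite z //; split=> // h gh.
by rewrite z ?g0P // ltW.
Qed.

End LogarithmSeries.

(** * An order isomorphism from an ordered field onto its positive half-line *)

Section PositiveHalfLine.
Variable F : realFieldType.
Implicit Types x y : F.

Definition to_pos x : F := if 0 <= x then 1 + x else (1 - x)^-1.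
Definition of_pos y : F := if 1 <= y then y - 1 else 1 - y^-1.

Lemma to_pos_gt0 x : 0 < to_pos x.
Proof.
rewrite /to_pos; case: (leP 0 x) => x0; first by rewrite (lt_le_trans ltr01) ?lerDl.
by rewrite invr_gt0 subr_gt0 (lt_trans x0).
Qed.

Lemma to_posK : cancel to_pos of_pos.
Proof.
move=> x; rewrite /to_pos /of_pos; case: (leP 0 x) => x0.
  by rewrite lerDl x0 addrAC subrr add0r.
have x1 : 0 < 1 - x by rewrite subr_gt0 (lt_trans x0).
by rewrite invf_ge1 // gerDl oppr_le0 leNgt x0 /= invrK subKr.
Qed.

Lemma of_posK y : 0 < y -> to_pos (of_pos y) = y.
Proof.
move=> y0; rewrite /to_pos /of_pos; case: (leP 1 y) => y1.
  by rewrite subr_ge0 y1 addrC subrK.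
by rewrite subr_ge0 invf_le1 // leNgt y1 /= subKr invrK.
Qed.

Lemma to_pos_lt x y : x < y -> to_pos x < to_pos y.
Proof.
move=> xy; rewrite /to_pos; case: (leP 0 x) => x0; case: (leP 0 y) => y0.
- by rewrite ltrD2l.
- by have := lt_trans xy y0; rewrite ltNge x0.
- apply: (@lt_le_trans _ _ 1); last by rewrite lerDl.
  by rewrite invf_lt1 ?ltrDl ?oppr_gt0 // addr_gt0 ?oppr_gt0.
- by rewrite ltf_pV2 ?posrE ?subr_gt0 ?(lt_trans _ ltr01) // ltrD2l ltrN2.
Qed.

End PositiveHalfLine.

(** * Moving the exponents of series along an order isomorphism from G onto its part above 1 *)

Section Relabelling.
Context (k : realFieldType) (d : Order.disp_t) (G : orderedAbelianGroupType d).
Context (d' : Order.disp_t) (kappa : orderType d').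
Context (kreg : regular_uncountable_cardinal kappa).
Local Notation K := (hahn k G kreg).
Implicit Types (x y : K) (g h : G).

Lemma rwo_image (A : set G) (f : G -> G) : reverse_well_ordered A ->
  (forall g h, A g -> A h -> (g <= h)%O -> (f g <= f h)%O) ->
  reverse_well_ordered (f @` A).
Proof.
move=> rA fle B BA [b Bb].
have [||m [Am Bm] mP] := rA [set g | A g /\ B (f g)]; first by move=> g [].
  by have [a Aa fa] := BA b Bb; exists a; split=> //; rewrite fa.
exists (f m) => // c Bc; have [a Aa fa] := BA c Bc; rewrite -fa.
by apply: fle => //; apply: mP; split=> //; rewrite fa.
Qed.

Variables phi psi : G -> G.
Hypothesis phi_gt1 : forall g, (1%g < phi g)%O.
Hypothesis phi_lt : forall g h, (g < h)%O -> (phi g < phi h)%O.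
Hypothesis phiK : cancel phi psi.
Hypothesis psiK : forall g, (1%g < g)%O -> phi (psi g) = g.

Lemma phi_le g h : (g <= h)%O -> (phi g <= phi h)%O.
Proof. by rewrite le_eqVlt => /orP[/eqP->//|/phi_lt/ltW]. Qed.

Lemma relabel_subproof x :
  hahn_support kappa (fun g => if (1%g < g)%O then x (psi g) else 0).
Proof.
apply: (@mkhahn_subproof _ _ _ _ _ kreg _ (phi @` support_set x)).
- by apply: rwo_image (supp_rwo (x := x)) _ => g h _ _; apply: phi_le.
- exact/small_image/supp_small.
- move=> g; case: ifP => [g1 xg|]; last by rewrite eqxx.
  by exists (psi g) => //; apply: psiK.
Qed.
Definition relabel x : K := Hahn kreg (relabel_subproof x).

Lemma relabelE x g : relabel x g = if (1%g < g)%O then x (psi g) else 0.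
Proof. by []. Qed.

(** Addition is coefficientwise, so it survives a renaming of exponents that respects only their
    order. *)
Lemma relabelD x y : relabel (x + y) = relabel x + relabel y.
Proof.
apply/hahnP => g; rewrite hahn_coefD !relabelE.
by case: ifP; rewrite ?hahn_coefD ?addr0.
Qed.

Lemma relabel_purely_infinite x : purely_infinite (relabel x).
Proof. by move=> g; rewrite relabelE; case: ifP => //; rewrite eqxx. Qed.

Lemma relabel_gt0 x : 0 < x -> 0 < relabel x.
Proof.
move=> /hahn_gt0P[g [xg gP]]; apply/hahn_gt0P; exists (phi g).
rewrite relabelE phi_gt1 phiK; split=> // h gh; rewrite relabelE.
case: ifP => // h1; apply: gP; rewrite ltNge; apply/negP => /phi_le.
by rewrite psiK // leNgt gh.
Qed.

Lemma relabel_surj y : purely_infinite y -> exists x, relabel x = y.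
Proof.
move=> y1.
have psi_le g h : (1%g < g)%O -> (1%g < h)%O -> (g <= h)%O -> (psi g <= psi h)%O.
  by move=> g1 h1 gh; rewrite leNgt; apply/negP => /phi_lt; rewrite !psiK // ltNge gh.
(* The preimage pulls [y] back along [phi]; nothing is lost because the support of [y] lies in the
   range of [phi]. *)
have xP : hahn_support kappa (fun g => y (phi g)).
  apply: (@mkhahn_subproof _ _ _ _ _ kreg _ (psi @` support_set y)).
  - by apply: rwo_image (supp_rwo (x := y)) _ => g h /y1 g1 /y1 h1; apply: psi_le.
  - exact/small_image/supp_small.
  - by move=> g yg; exists (phi g).
exists (Hahn kreg xP); apply/hahnP => g; rewrite relabelE /=.
case: ifP => [g1|g1]; first by rewrite psiK.
by apply/esym/eqP/negPn/negP => /y1; rewrite g1.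
Qed.

End Relabelling.

(** * The logarithm on monomials obtained from an omega-map *)

Section OmegaLogarithm.
Context (k : realFieldType) (d : Order.disp_t) (G : orderedAbelianGroupType d).
Context (d' : Order.disp_t) (kappa : orderType d').
Context (kreg : regular_uncountable_cardinal kappa).
Local Notation K := (hahn k G kreg).
Implicit Types (x y : K) (g h : G).

Lemma monomialE g h : (monomial g : K) h = if h == g then 1 else 0.
Proof. by []. Qed.

Lemma monomial_inj : injective (monomial : G -> K).
Proof.
move=> g h /hahnP/(_ g)/eqP; rewrite !monomialE eqxx; case: (g =P h) => // _.
by rewrite oner_eq0.
Qed.

Lemma monomialM g h : monomial (g * h)%g = monomial g * monomial h :> K.
Proof.
apply/hahnP => j; rewrite hahn_term_mulE mul1r !monomialE.
by rewrite -(inj_eq (mulgI g) (g^-1 * j)%g h) mulVKg.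
Qed.

Lemma monomial_lt g h : (g < h)%O -> monomial g < monomial h :> K.
Proof.
move=> gh; rewrite -subr_gt0; apply/hahn_gt0P; exists h.
rewrite hahn_coefB !monomialE eqxx gt_eqF // subr0; split=> // j hj.
by rewrite hahn_coefB !monomialE !gt_eqF ?subr0 // (lt_trans gh).
Qed.

(* If omega identifies K with G, then G is order isomorphic to its part above 1  *)
(* as K is to its positive half-line; log g is the omega-exponent of g with its  *)
(* monomials moved along this isomorphism.                                       *)
Lemma omega_monomial_log (omega : K -> K) :
  omega_map (@hahn_monomials k d G d' kappa kreg) omega ->
  exists lam : G -> K, [/\ {morph lam : g h / (g * h)%g >-> g + h},
    forall g, (1%g < g)%O -> 0 < lam g &
    range lam = @purely_infinite k d G d' kappa kreg].
Proof.
move=> [[oM oI oS] oD olt].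
(* [w] is omega with values read in G, and [v] is its inverse. *)
have /choice[w wP] : forall x, exists g, monomial g = omega x.
  by move=> x; have [g _ <-] := oM x I; exists g.
have /choice[v vP] : forall g, exists x, omega x = monomial g.
  by move=> g; have [x _ xg] := oS (monomial g) (ex_intro2 _ _ g I erefl); exists x.
have oinj x y : omega x = omega y -> x = y by apply: oI; rewrite inE.
have vK : cancel v w by move=> g; apply: monomial_inj; rewrite wP vP.
have wK : cancel w v by move=> x; apply: oinj; rewrite vP wP.
have wD x y : w (x + y) = (w x * w y)%g.
  by apply: monomial_inj; rewrite monomialM !wP oD.
have w0 : w 0 = 1%g by apply: (mulgI (w 0)); rewrite -wD addr0 mulg1.
have vM g h : v (g * h)%g = v g + v h.
  by apply: oinj; rewrite oD !vP monomialM.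
have wlt x y : x < y -> (w x < w y)%O.
  move=> /olt; rewrite -!wP; case: (ltgtP (w x) (w y)) => // [/monomial_lt yx xy|->].
    by have := lt_trans xy yx; rewrite ltxx.
  by rewrite ltxx.
have vlt g h : (g < h)%O -> v g < v h.
  move=> gh; case: (ltgtP (v g) (v h)) => // [/wlt|/(congr1 w)]; rewrite !vK.
    by move=> hg; have := lt_trans gh hg; rewrite ltxx.
  by move=> e; move: gh; rewrite e ltxx.
(* Conjugating by [w] turns the map from K onto its positive part into one from G onto its part
   above [w 0], which is 1. *)
pose phi g := w (to_pos (v g)); pose psi g := w (of_pos (v g)).
have phi1 g : (1%g < phi g)%O by rewrite -w0; apply/wlt/to_pos_gt0.
have philt g h : (g < h)%O -> (phi g < phi h)%O by move=> /vlt/to_pos_lt/wlt.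
have phiK : cancel phi psi by move=> g; rewrite /psi wK to_posK vK.
have v1 : v 1%g = 0 by rewrite -w0 wK.
have psiK g : (1%g < g)%O -> phi (psi g) = g.
  by move=> /vlt; rewrite v1 /phi wK => /of_posK->; rewrite vK.
exists (relabel philt psiK \o v); split.
- by move=> g h /=; rewrite vM relabelD.
- by move=> g /vlt; rewrite v1 => /(relabel_gt0 phi1 philt phiK psiK).
apply/seteqP; split=> [_ [g _ <-]|y /(relabel_surj philt phiK psiK)[x <-]].
  exact: relabel_purely_infinite.
by exists (w x) => //=; rewrite wK.
Qed.

End OmegaLogarithm.

(** * Decomposition of positive series into a leading term and a factor 1 + e *)

Section LeadingTerm.
Context (k : realFieldType) (d : Order.disp_t) (G : orderedAbelianGroupType d).
Context (d' : Order.disp_t) (kappa : orderType d').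
Context (kreg : regular_uncountable_cardinal kappa).
Local Notation K := (hahn k G kreg).
Implicit Types (x y e : K) (g h : G) (r : k).

Lemma hahn_termM g h r r' :
  hahn_term (g * h)%g (r * r') = hahn_term g r * hahn_term h r' :> K.
Proof.
apply/hahnP => j; rewrite hahn_term_mulE /=.
rewrite -(inj_eq (mulgI g) (g^-1 * j)%g h) mulVKg.
by case: ifP; rewrite ?mulr0.
Qed.

Lemma lead_coefE g r e : infinitesimal e -> (hahn_term g r * (1 + e)) g = r.
Proof.
move=> e1; rewrite hahn_term_mulE mulVg hahn_coefD hahn_coef1 eqxx.
by rewrite (infinitesimal_coef_ge1 e1) // addr0 mulr1.
Qed.

Lemma coef_gt_lead g r e h : infinitesimal e -> (g < h)%O ->
  (hahn_term g r * (1 + e)) h = 0.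
Proof.
move=> e1 gh; have h1 : (1%g < (g^-1 * h)%g)%O by rewrite -(mulVg g) oag_ltM2l.
rewrite hahn_term_mulE hahn_coefD hahn_coef1 gt_eqF // add0r.
by rewrite (infinitesimal_coef_ge1 e1) ?mulr0 // ltW.
Qed.

Lemma positive_decomp x : 0 < x -> exists g r e,
  [/\ 0 < r, infinitesimal e & x = hahn_term g r * (1 + e)].
Proof.
move=> /hahn_gt0P[g [xg gP]]; exists g, (x g), (hahn_term g^-1%g (x g)^-1 * x - 1).
split=> // [h|]; last first.
  rewrite addrC subrK mulrA -hahn_termM mulgV divff ?gt_eqF //.
  by rewrite -/(hahn_const 1) hahn_const1 mul1r.
rewrite hahn_coefB hahn_coef1 hahn_term_mulE invgK.
case: (ltgtP h 1%g) => //= [h1|->]; last by rewrite mulg1 mulVf ?subrr ?eqxx ?gt_eqF.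
have -> : x (g * h)%g = 0; last by rewrite mulr0 subr0 eqxx.
by apply: gP; rewrite -[X in (X < _)%O]mulg1 oag_ltM2l.
Qed.

Lemma decomp_uniq g r e g' r' e' : 0 < r -> 0 < r' ->
  infinitesimal e -> infinitesimal e' ->
  hahn_term g r * (1 + e) = hahn_term g' r' * (1 + e') -> [/\ g = g', r = r' & e = e'].
Proof.
move=> r0 r0' e1 e1' E.
have gg : g = g'.
  case: (ltgtP g g') => // gg.
    have := coef_gt_lead r e1 gg; rewrite E lead_coefE // => r'E.
    by rewrite r'E ltxx in r0'.
  have := coef_gt_lead r' e1' gg; rewrite -E lead_coefE // => rE.
  by rewrite rE ltxx in r0.
have rr : r = r' by rewrite -(lead_coefE g r e1) E gg lead_coefE.
split=> //; apply: (addrI 1); apply: (@mulfI _ (hahn_term g r)).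
  by apply/eqP => /hahnP/(_ g) /=; rewrite eqxx => rE; rewrite rE ltxx in r0.
by rewrite E gg rr.
Qed.

(** If [e] had a monomial at least 1, the leading monomial of its absolute value would be at least 1
    too, and a suitable constant multiple would exceed 1. *)
Lemma hahn_prec1_infinitesimal e : hahn_prec e 1 -> infinitesimal e.
Proof.
move=> ep h eh; rewrite ltNge; apply/negP => h1.
have e0 : `|e| != 0 by rewrite normr_eq0; apply/eqP => e0; rewrite e0 eqxx in eh.
have /positive_decomp[g [r [u [r0 u1 eE]]]] : 0 < `|e| by rewrite lt_def e0 normr_ge0.
have hg : (h <= g)%O.
  rewrite leNgt; apply/negP => gh; move/eqP: eh; apply.
  have := coef_gt_lead r u1 gh; rewrite -eE.
  by case: (ger0P e) => // _; rewrite hahn_coefN => /eqP; rewrite oppr_eq0 => /eqP.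
(* This constant makes the coefficient at [g] equal to 2, more than the coefficient of 1 at [g],
   which is 0 or 1. *)
have := ep (2 / r) (divr_gt0 (ltr0n _ 2) r0).
rewrite normr1 -subr_gt0 => /hahn_gt0P[j [jP jmax]].
have cE i : (1 - hahn_const (2 / r) * `|e|) i =
    (if i == 1%g then 1 else 0) - 2 / r * `|e| i.
  by rewrite hahn_coefB hahn_coef1 hahn_constMcoef.
have eg : `|e| g = r by rewrite eE lead_coefE.
have neg : (1 - hahn_const (2 / r) * `|e|) g < 0.
  rewrite cE eg (divfK (lt0r_neq0 r0)) subr_lt0; case: ifP => _; last by rewrite ltr0n.
  by rewrite ltr1n.
case: (ltgtP j g) => jg.
- by rewrite jmax ?ltxx in neg.
- move: jP; rewrite cE eE coef_gt_lead // mulr0 subr0 gt_eqF ?ltxx //.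
  by apply: le_lt_trans jg; apply: le_trans hg.
- by rewrite jg in jP; have := lt_trans jP neg; rewrite ltxx.
Qed.

Lemma hahn_gt0_dominant x y g : 0 < x g -> (forall h, (g < h)%O -> x h = 0) ->
  (forall h, (g <= h)%O -> y h = 0) -> 0 < x + y.
Proof.
move=> xg xP yP; apply/hahn_gt0P; exists g; rewrite hahn_coefD yP // addr0.
by split=> // h gh; rewrite hahn_coefD xP // yP ?addr0 // ltW.
Qed.

End LeadingTerm.

(** * The logarithm on all positive series *)

Section Assembly.
Context (k : rcfType) (expk logk : k -> k).
Hypothesis kexp : exponential_field expk logk.
Context (d : Order.disp_t) (G : orderedAbelianGroupType d).
Context (d' : Order.disp_t) (kappa : orderType d').
Context (kreg : regular_uncountable_cardinal kappa).
Local Notation K := (hahn k G kreg).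
Implicit Types (x y e : K) (g h : G) (r : k).

Lemma expk0 : expk 0 = 1.
Proof.
apply: (@mulfI _ (expk 0)); first by rewrite gt_eqF ?(expk_gt0 kexp).
by rewrite -(expk_add kexp) addr0 mulr1.
Qed.

Lemma logk1 : logk 1 = 0.
Proof. by rewrite -expk0 (expkK kexp). Qed.

Lemma logkM r r' : 0 < r -> 0 < r' -> logk (r * r') = logk r + logk r'.
Proof.
move=> r0 r'0; rewrite -[in LHS](logkK kexp r0) -[in LHS](logkK kexp r'0).
by rewrite -(expk_add kexp) (expkK kexp).
Qed.

Lemma logk_gt0 r : 1 < r -> 0 < logk r.
Proof.
move=> r1; have rE := logkK kexp (lt_trans ltr01 r1).
case: (ltgtP 0 (logk r)) => // [/(expk_lt kexp)|l0].
  by rewrite rE expk0 => /(lt_trans r1); rewrite ltxx.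
by move: r1; rewrite -rE -l0 expk0 ltxx.
Qed.

Variable lam : G -> K.
Hypothesis lamM : {morph lam : g h / (g * h)%g >-> g + h}.
Hypothesis lam_gt0 : forall g, (1%g < g)%O -> 0 < lam g.
Hypothesis lam_range : range lam = @purely_infinite k d G d' kappa kreg.

(** Stated through a relation because the decomposition is only known to exist; [decomp_uniq] makes
    it single-valued. The default 0 covers series without such a decomposition. *)
Definition hahn_log x : K := xget 0 [set y | exists g r e,
  [/\ 0 < r, infinitesimal e, x = hahn_term g r * (1 + e) &
      y = lam g + hahn_const (logk r) + log1p e]].

Lemma hahn_logE g r e : 0 < r -> infinitesimal e ->
  hahn_log (hahn_term g r * (1 + e)) = lam g + hahn_const (logk r) + log1p e.
Proof.
move=> r0 e1; rewrite /hahn_log.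
case: xgetP => [y _|/(_ (lam g + hahn_const (logk r) + log1p e))].
  move=> [g' [r' [e' [r0' e1' xE ->]]]].
  by have [<- <- <-] := decomp_uniq r0 r0' e1 e1' xE.
by case; exists g, r, e.
Qed.

Lemma lam1 : lam 1%g = 0.
Proof. by apply: (addrI (lam 1%g)); rewrite -lamM mulg1 addr0. Qed.

Lemma lam_purely_infinite g : purely_infinite (lam g).
Proof. by rewrite -lam_range; exists g. Qed.

Lemma hahn_logM x y : 0 < x -> 0 < y -> hahn_log (x * y) = hahn_log x + hahn_log y.
Proof.
move=> /positive_decomp[g [r [a [r0 a1 ->]]]] /positive_decomp[h [r' [b [r0' b1 ->]]]].
have c1 : infinitesimal (a + b + a * b).
  pose E1 : set G := [set i | (i < 1%g)%O].
  have aE : hfilt E1 1 a by apply: hfilt_supp.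
  have bE : hfilt E1 1 b by apply: hfilt_supp.
  have abE : hfilt E1 1 (a * b) by apply: (@hfilt_le _ _ _ _ _ _ _ 1 2) (hfiltM aE bE).
  by apply: (@infinitesimal_hfilt _ _ _ _ _ _ E1) => //; do ![apply: hfiltD => //].
have -> : hahn_term g r * (1 + a) * (hahn_term h r' * (1 + b)) =
    hahn_term (g * h)%g (r * r') * (1 + (a + b + a * b)).
  by rewrite hahn_termM; move: (hahn_term g r) (hahn_term h r') => u v; ring.
rewrite !hahn_logE ?mulr_gt0 // lamM logkM // hahn_constD log1p_mul //.
move: (lam g) (lam h) (hahn_const _) (hahn_const _) (log1p a) (log1p b) => *; ring.
Qed.

(** The three summands of the logarithm are supported above 1, at 1 and below 1, so the first
    nonzero one decides the sign. Likewise 1 < x means g > 1, or g = 1 and r > 1, or g = r = 1 and e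
    > 0. *)
Lemma hahn_log_gt0 x : 1 < x -> 0 < hahn_log x.
Proof.
move=> x1; have /positive_decomp[g [r [e [r0 e1 xE]]]] := lt_trans ltr01 x1.
rewrite xE hahn_logE //.
have le1 h : (1%g <= h)%O -> log1p e h = 0.
  exact/infinitesimal_coef_ge1/infinitesimal_log1p.
case: (ltgtP g 1%g) => g1.
- move: x1; rewrite ltNge => /negP; case; apply: ltW; rewrite -subr_gt0.
  apply/hahn_gt0P; exists 1%g; rewrite hahn_coefB hahn_coef1 eqxx xE coef_gt_lead //.
  rewrite subr0; split=> // h h1.
  by rewrite hahn_coefB hahn_coef1 gt_eqF // coef_gt_lead ?subr0 // (lt_trans g1).
- have /hahn_gt0P[h [lh hP]] := lam_gt0 g1.
  have h1 : (1%g < h)%O by apply: (lam_purely_infinite (g := g)); rewrite gt_eqF.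
  rewrite -addrA; apply: (hahn_gt0_dominant lh hP) => j hj.
  have j1 := lt_le_trans h1 hj.
  by rewrite hahn_coefD hahn_constE gt_eqF // le1 ?addr0 // ltW.
rewrite g1 lam1 add0r; case: (ltgtP r 1) => r1.
- move: x1; rewrite ltNge => /negP; case; apply: ltW; rewrite -subr_gt0.
  have xr : x 1%g = r by rewrite xE -g1 lead_coefE.
  apply/hahn_gt0P; exists 1%g; rewrite hahn_coefB hahn_coef1 eqxx xr.
  rewrite subr_gt0; split=> // h h1.
  by rewrite hahn_coefB hahn_coef1 gt_eqF // xE coef_gt_lead ?subr0 // g1.
- apply: (hahn_gt0_dominant (g := 1%g)) => //.
    by rewrite hahn_constE eqxx logk_gt0.
  by move=> h h1; rewrite hahn_constE gt_eqF.
rewrite r1 logk1 hahn_const0 add0r; apply: log1p_gt0 => //.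
move: x1; rewrite xE g1 r1 -/(hahn_const 1) hahn_const1 mul1r.
by rewrite ltrDl.
Qed.

(** Cut [y] into its parts above, at and below the monomial 1; these are the logarithms of a
    monomial, of a constant and of some 1 + e. *)
Lemma hahn_log_surj y : exists2 x, 0 < x & hahn_log x = y.
Proof.
have pP (P : pred G) : hahn_support kappa (fun g => if P g then y g else 0).
  apply: (@mkhahn_subproof _ _ _ _ _ kreg _ _ (supp_rwo (x := y)) (supp_small (x := y))).
  by move=> g; case: ifP => // _; rewrite eqxx.
have [g _ gE] : range lam (Hahn kreg (pP (fun g => 1%g < g)%O)).
  by rewrite lam_range => g /=; case: ifP => //; rewrite eqxx.
have [|e e1 eE] := @log1p_surj _ _ _ _ _ _ (Hahn kreg (pP (fun g => g < 1%g)%O)).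
  by move=> h /=; case: ifP => //; rewrite eqxx.
have r0 := expk_gt0 kexp (y 1%g).
exists (hahn_term g (expk (y 1%g)) * (1 + e)).
  apply/hahn_gt0P; exists g; rewrite lead_coefE //; split=> // h.
  exact: coef_gt_lead.
rewrite hahn_logE // (expkK kexp) gE eE; apply/hahnP => h.
rewrite !hahn_coefD hahn_constE /=.
by case: (ltgtP h 1%g) => [||->]; rewrite ?addr0 ?add0r.
Qed.

Lemma hahn_log_analytic : analytic_logarithm logk hahn_log.
Proof.
have term1 r : hahn_const r = hahn_term 1%g r * (1 + 0) :> K.
  by rewrite addr0 mulr1.
split.
- exact: hahn_logM.
- move=> x y x0 xy; have y0 := lt_trans x0 xy.
  (* Monotonicity reduces to positivity of the logarithm of y / x > 1. *)
  rewrite -[y](divfK (lt0r_neq0 x0)) hahn_logM ?divr_gt0 // ltrDr.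
  by apply: hahn_log_gt0; rewrite ltr_pdivlMr // mul1r.
- exact: hahn_log_surj.
- move=> r r0; rewrite term1 hahn_logE //; last exact: infinitesimal0.
  by rewrite lam1 log1p0 add0r addr0.
- move=> e /hahn_prec1_infinitesimal e1.
  have -> : 1 + e = hahn_term 1%g 1 * (1 + e).
    by rewrite -/(hahn_const 1) hahn_const1 mul1r.
  by rewrite hahn_logE // lam1 logk1 hahn_const0 !add0r; apply: log1p_sum.
have lamE g : hahn_log (monomial g) = lam g.
  have -> : monomial g = hahn_term g 1 * (1 + 0) :> K by rewrite addr0 mulr1.
  rewrite hahn_logE //; last exact: infinitesimal0.
  by rewrite logk1 hahn_const0 log1p0 !addr0.
rewrite -lam_range; apply/seteqP; split=> [_ [_ [g _ <-] <-]|_ [g _ <-]].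
  by exists g => //; rewrite lamE.
by exists (monomial g); [exists g|].
Qed.

End Assembly.

(** * Conclusion for exponential fields and for the reals *)

Lemma omega_field_analytic_logarithm (d' : Order.disp_t) (kappa : orderType d')
    (kreg : regular_uncountable_cardinal kappa) (k : rcfType) (expk logk : k -> k)
    (d : Order.disp_t) (G : orderedAbelianGroupType d) :
  exponential_field expk logk -> hahn_omega_field k G kreg ->
  exists log : hahn k G kreg -> hahn k G kreg, analytic_logarithm logk log.
Proof.
move=> kexp [_ _ _ [omega /omega_monomial_log[lam [lamM lam_gt0 lam_range]]]].
by exists (hahn_log logk lam); exact: (hahn_log_analytic kexp).
Qed.

Lemma realType_exponential_field (R : realType) :
  exponential_field (@sequences.expR R) (@ln R).
Proof.
split.
- exact: expRD.
- by move=> a b; rewrite ltr_expR.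
- exact: expR_gt0.
- exact: expRK.
- by move=> a a0; apply: lnK; rewrite posrE.
Qed.

Theorem theorem3p4 (d' : Order.disp_t) (kappa : orderType d')
    (kappa_reg : regular_uncountable_cardinal kappa) :
  (forall (R : realType) (d : Order.disp_t) (G : orderedAbelianGroupType d),
     hahn_omega_field R G kappa_reg ->
     exists log : hahn R G kappa_reg -> hahn R G kappa_reg,
       analytic_logarithm (@ln R) log)
  /\
  (forall (k : rcfType) (expk logk : k -> k), exponential_field expk logk ->
   forall (d : Order.disp_t) (G : orderedAbelianGroupType d),
     hahn_omega_field k G kappa_reg ->
     exists log : hahn k G kappa_reg -> hahn k G kappa_reg,
       analytic_logarithm logk log).
Proof.
split=> [R d G|k expk logk kexp d G].
  exact: (omega_field_analytic_logarithm (realType_exponential_field R)).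
exact: (omega_field_analytic_logarithm kexp).
Qed.
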